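(* Let $\varepsilon=MN^{-1}$, $c=N^{1/2}C$ and $\varrho(w)=N^{-1/2}\lambda(N^{-1/2}w)$ for $|w|\le c$. Consider the dynamic programming equation $$r_\varepsilon(x,t)=\min\bigl(r_{1,\varepsilon}(x,t),r_{2,\varepsilon}(x,t)\bigr),$$ where $t$ is a nonnegative multiple of $\varepsilon$ with $t\le1$, $r_{1,\varepsilon}(x,1)=r_{2,\varepsilon}(x,1)=0$, and $$r_{1,\varepsilon}(x,t)=(1-t)g_1(x,t),\qquad r_{2,\varepsilon}(x,t)=\varepsilon g_2(x,t)+r_\varepsilon(x,t+\varepsilon)*f_{\varepsilon D}(x)$$ for $0\le t<1$, with $$g_1(x,t)=\int_0^c w\exp\left(D^{-1}(xw-0.5\,tw^2)\right)\varrho(w)\,dw,$$ $$g_2(x,t)=\int_{-c}^0|w|\exp\left(D^{-1}(xw-0.5\,tw^2)\right)\varrho(w)\,dw.$$ Then the Bayesian risk (over strategies that process the data in batches of size $M$) is $$R^B_N(\lambda)=N^{1/2}r_\varepsilon(0,0).$$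
   Context: Gaussian densities: for a variance $V>0$, $f_V(x|a)=(2\pi V)^{-1/2}\exp\{-(x-a)^2/(2V)\}$ and $f_V(x)=f_V(x|0)$. Convolution is taken in the $x$ variable: $F(x)*G(x)=\int_{-\infty}^{\infty}F(x-y)G(y)\,dy$. Gaussian one-armed bandit: fix $D>0$, $0<C<\infty$ and positive integers $N,M$ with $N$ a multiple of $M$. At each step $i=1,\dots,N$ an action $y_i\in\{1,2\}$ is chosen and a random income $\xi_i$ depending only on the current action is received. If $y_i=2$, $\xi_i$ has density $f_D(x|m)$ with $D$ known and $m$ unknown; if $y_i=1$, $\xi_i$ has a known distribution with expectation $0$. The parameter is $\theta=(0,m)$, with $|m|\le C$, i.e. $|w|\le c$ for $w=N^{1/2}m$. Strategies: the history is described by $(k,X,n)$, where $k,n$ are the numbers of past applications of the first and the second action and $X$ is the cumulative income from the second action ($X=0$ if $n=0$). A strategy $\sigma$ assigns to each history a (possibly randomized) selection of the next action, and only strategies that may change the action after applying it $M$ times in succession are used: a selection is made when $k,n$ are multiples of $M$ and the selected action is used for the next $M$ steps. Scaled variables: $t=n/N$, $x=N^{-1/2}X$. Loss: $L_N(\sigma,\theta)=N\max(0,m)-\mathrm{E}_{\sigma,\theta}\bigl(\sum_{i=1}^N\xi_i\bigr)$. Prior: $\lambda$ is a probability density of $m$ on $[-C,C]$ with $\int_{-C}^0|m|\lambda(m)\,dm>0$ and $\int_0^C m\lambda(m)\,dm>0$. Bayesian risk: $R^B_N(\lambda)=\min_{\sigma}\int_{-C}^{C}L_N(\sigma,(0,m))\,\lambda(m)\,dm$.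 *)

(* Defs.v *)
From HB Require Import structures.
From mathcomp Require Import all_boot all_order all_algebra.
From mathcomp Require Import all_classical all_reals all_analysis.
From mathcomp Require Import measurable_realfun.

Set Implicit Arguments.
Unset Strict Implicit.
Unset Printing Implicit Defensive.

Import Order.TTheory GRing.Theory Num.Theory.
Import numFieldNormedType.Exports.

Local Open Scope classical_set_scope.
Local Open Scope ring_scope.

(* The library's [normal_pdf] takes the standard deviation, f_V the variance. *)
Definition gauss_density (R : realType) (V a x : R) : R :=
  normal_pdf a (Num.sqrt V) x.

Lemma gauss_densityE (R : realType) (V a x : R) : 0 < V ->
  gauss_density V a x =
  (Num.sqrt (2 * pi * V))^-1 * expR (- (x - a) ^+ 2 / (2 * V)).
Proof.
move=> V0; rewrite /gauss_density normal_pdfE ?gt_eqF ?sqrtr_gt0//.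
rewrite /normal_peak /normal_fun sqr_sqrtr ?ltW//.
by rewrite -(mulr_natl (V * pi)) -(mulr_natl V) mulrAC mulrA.
Qed.

Definition convolution (R : realType) (F G : R -> R) (x : R) : R :=
  \int[lebesgue_measure]_y (F (x - y) * G y).

Definition minimum_of (R : realType) (A : set R) (v : R) : Prop :=
  A v /\ lbound A v.

(* The law obtained by drawing x from P and then a point from K x. *)
Section kernel_bind.
Context d1 d2 (X : measurableType d1) (Y : measurableType d2) (R : realType).
Variables (P : probability X R) (K : R.-pker X ~> Y).
Local Open Scope ereal_scope.

Definition kernel_bind (A : set Y) : \bar R := \int[P]_x K x A.

Let bind0 : kernel_bind set0 = 0.
Proof. by apply: integral0_eq => x _; rewrite measure0. Qed.

Let bind_ge0 A : 0 <= kernel_bind A.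
Proof. by apply: integral_ge0 => x _. Qed.

Let bind_sigma_additive : semi_sigma_additive kernel_bind.
Proof.
move=> F mF tF mUF.
have -> : kernel_bind (\bigcup_n F n) = \sum_(0 <= n <oo) kernel_bind (F n).
  rewrite /kernel_bind -integral_nneseries//; last first.
    by move=> n; exact: measurable_kernel.
  apply: eq_integral => x _.
  by apply/esym/cvg_lim => //; exact: measure_semi_sigma_additive.
by apply: is_cvg_nneseries => n _ _; exact: bind_ge0.
Qed.

HB.instance Definition _ := isMeasure.Build _ _ _ kernel_bind
  bind0 bind_ge0 bind_sigma_additive.

Let bind_setT : kernel_bind setT = 1.
Proof.
rewrite /kernel_bind (eq_integral (cst 1)); last first.
  by move=> x _; rewrite prob_kernel.
by rewrite integral_cst// mul1e; exact: probability_setT.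
Qed.

HB.instance Definition _ :=
  Measure_isProbability.Build _ _ _ kernel_bind bind_setT.

End kernel_bind.

(* Actions are booleans: [false] is the first action (income law P1), [true] the
   second one (normal income of mean m and variance D). A trajectory of length i
   lists the pairs (action, income) of the first i steps. *)
Section bandit.
Context (R : realType).

Notation trajectory i := (i.-tuple (bool * R)%type).

Definition count1 (h : seq (bool * R)) : nat := count (fun e => ~~ e.1) h.
Definition count2 (h : seq (bool * R)) : nat := count (fun e => e.1) h.
Definition income2 (h : seq (bool * R)) : R := \sum_(e <- h | e.1) e.2.
Definition total_income (h : seq (bool * R)) : R := \sum_(e <- h) e.2.

(* [select2 k X n] is the probability of selecting the second action when the
   history is (k, X, n). *)
Record strategy := Strategy {
  select2 : nat -> R -> nat -> R ;
  select2_01 : forall k X n, 0 <= select2 k X n <= 1 ;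
  measurable_select2 : forall k n,
    measurable_fun [set: R] (fun X => select2 k X n) }.

(* Conditional probability that the second action is used at the next step: a
   selection takes place if k and n are multiples of M, otherwise the last
   action is repeated. *)
Definition prob2 (M : nat) (sigma : strategy) (h : seq (bool * R)) : R :=
  if (M %| count1 h)%N && (M %| count2 h)%N
  then select2 sigma (count1 h) (income2 h) (count2 h)
  else ((last (false, 0) h).1 : bool)%:R.

Context (M : nat) (D : R) (P1 : probability (measurableTypeR R) R).
Context (sigma : strategy) (m : R).

Definition income_law (y : bool) : probability (measurableTypeR R) R :=
  if y then (normal_prob m (Num.sqrt D) : probability _ R) else P1.

Section step.
Variable i : nat.
Local Open Scope ereal_scope.

Definition extend (h : trajectory i) (y : bool) (x : measurableTypeR R) :
    trajectory i.+1 :=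
  [tuple of rcons h (y, x)].

Lemma measurable_extend (y : bool) :
  measurable_fun setT
    (fun hx : trajectory i * measurableTypeR R => extend hx.1 y hx.2).
Proof.
apply/measurable_fun_tnthP => j.
have [ji|ij] := ltnP j i.
  rewrite (_ : _ \o _ = (fun h => tnth h (Ordinal ji)) \o fst); last first.
    apply/funext => -[h x] /=; rewrite !(tnth_nth (y, 0%R))/= nth_rcons.
    by rewrite size_tuple ji.
  by apply: measurableT_comp => //; exact: measurable_tnth.
rewrite (_ : _ \o _ = (fun hx => (y, hx.2 : R))).
  exact: measurable_fun_pair.
apply/funext => -[h x] /=; rewrite !(tnth_nth (y, 0%R))/= nth_rcons.
rewrite size_tuple ltnNge ij/=.
by rewrite ifT// eqn_leq ij -ltnS ltn_ord.
Qed.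

Let measurable_extend2 h y : measurable_fun setT (extend h y).
Proof.
exact: (measurableT_comp (measurable_extend y) (pair1_measurable h)).
Qed.

HB.instance Definition _ h y :=
  isMeasurableFun.Build _ _ _ _ (extend h y) (measurable_extend2 h y).

Definition arm_step (h : trajectory i) :
    bool -> {measure set (trajectory i.+1) -> \bar R} :=
  fun y => distribution (income_law y) (extend h y).

Let arm_step_measurable h A : measurable A ->
  measurable_fun [set: bool] (arm_step h ^~ A : bool -> \bar R).
Proof. by []. Qed.

HB.instance Definition _ h :=
  isKernel.Build _ _ _ _ _ (arm_step h) (@arm_step_measurable h).

Let arm_step_setT h y : arm_step h y setT = 1.
Proof. exact: probability_setT. Qed.

HB.instance Definition _ h :=
  Kernel_isProbability.Build _ _ _ _ _ (arm_step h) (arm_step_setT h).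

(* Law of the trajectory of length i.+1 given its first i steps. *)
Definition step (h : trajectory i) :
    {measure set (trajectory i.+1) -> \bar R} :=
  kernel_bind (bernoulli_prob (prob2 M sigma h)) (arm_step h).

Lemma prob2_01 h : (0 <= prob2 M sigma h <= 1)%R.
Proof.
rewrite /prob2; case: ifP => _; first exact: select2_01.
by case: (last _ _).1; rewrite /= ?lexx ?ler01.
Qed.

Lemma measurable_fst_tnth (j : 'I_i) :
  measurable_fun setT (fun h : trajectory i => (tnth h j).1).
Proof. by apply: measurableT_comp => //; exact: measurable_tnth. Qed.

Lemma measurable_snd_tnth (j : 'I_i) :
  measurable_fun setT (fun h : trajectory i => (tnth h j).2).
Proof. by apply: measurableT_comp => //; exact: measurable_tnth. Qed.

Lemma measurable_income2 :
  measurable_fun setT (fun h : trajectory i => income2 h).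
Proof.
under eq_fun do rewrite /income2 big_mkcond big_tuple /=.
apply: measurable_sum => j; apply: measurable_fun_ifT => //.
- exact: measurable_fst_tnth.
- exact: measurable_snd_tnth.
Qed.

(* For a fixed sequence b of actions, prob2 is a measurable function of the
   income; there are finitely many such b. *)
Lemma measurable_prob2 :
  measurable_fun setT (fun h : trajectory i => prob2 M sigma h).
Proof.
pose F (b : i.-tuple bool) (X : R) : R :=
  if (M %| count negb b)%N && (M %| count id b)%N
  then select2 sigma (count negb b) X (count id b)
  else (last false b : bool)%:R.
have FE (h : trajectory i) :
    prob2 M sigma h = F [tuple of map fst h] (income2 h).
  rewrite /prob2 /F /count1 /count2 /= !count_map.
  by rewrite (last_map fst h (false, 0%R)).
have -> : (fun h : trajectory i => prob2 M sigma h) = fun h : trajectory i =>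
    (\sum_(b : i.-tuple bool)
      (\prod_(j < i) (if (tnth h j).1 == tnth b j then 1 else 0)) *
      F b (income2 h))%R.
  apply/funext => h; rewrite FE.
  rewrite (bigD1 [tuple of map fst h])//= big1 ?mul1r => [|j _]; last first.
    by rewrite tnth_map eqxx.
  rewrite big1 ?addr0// => b bh.
  have [j jP] : exists j, (tnth h j).1 != tnth b j.
    apply/existsP; move: bh; apply: contraR; rewrite negb_exists => /forallP H.
    apply/eqP/eq_from_tnth => j; rewrite tnth_map.
    by have := H j; rewrite negbK => /eqP.
  by rewrite (bigD1 j)//= (negbTE jP) !mul0r.
apply: measurable_sum => b; apply: measurable_funM.
  apply: measurable_prod => j _; apply: measurable_fun_ifT => //.
  exact: (measurableT_comp (_ : measurable_fun setT (eq_op^~ (tnth b j)))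
    (measurable_fst_tnth j)).
suff mF : measurable_fun setT (F b).
  exact: (measurableT_comp mF measurable_income2).
by rewrite /F; case: (_ && _) => //; exact: measurable_select2.
Qed.

Let step_measurable A : measurable A ->
  measurable_fun setT (step ^~ A : trajectory i -> \bar R).
Proof.
move=> mA.
have armE y : measurable_fun setT (fun h : trajectory i => arm_step h y A).
  have mB : measurable ((fun hx : trajectory i * measurableTypeR R =>
      extend hx.1 y hx.2) @^-1` A).
    by rewrite -[X in measurable X]setTI; exact: measurable_extend.
  apply: eq_measurable_fun (measurable_fun_xsection (income_law y) mB) => h _.
  by rewrite /arm_step /= /distribution /pushforward /= /xsection;
    congr (income_law y _); apply/seteqP; split => x /=; rewrite inE.
under eq_fun do
  rewrite /step /= /kernel_bind integral_bernoulli_prob ?prob2_01//.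
apply: emeasurable_funD; apply: emeasurable_funM => //.
- by apply/measurable_EFinP; exact: measurable_prob2.
- exact: armE.
- apply/measurable_EFinP; apply: measurable_funB => //.
  exact: measurable_prob2.
- exact: armE.
Qed.

HB.instance Definition _ := isKernel.Build _ _ _ _ _ step step_measurable.

Let step_setT h : step h setT = 1.
Proof. exact: probability_setT. Qed.

HB.instance Definition _ :=
  Kernel_isProbability.Build _ _ _ _ _ step step_setT.

End step.

Fixpoint trajectory_law (i : nat) : probability (trajectory i) R :=
  if i is j.+1 then kernel_bind (trajectory_law j) (@step j)
  else \d_([tuple] : trajectory 0).

Definition loss (N : nat) : R :=
  N%:R * Num.max 0 m -
  fine 'E_(trajectory_law N)[fun h : trajectory N => total_income h].

End bandit.

Arguments loss {R} M D P1 sigma m N.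

Section bayes.
Context (R : realType).
Implicit Types (C D c eps t x : R) (lambda rho : R -> R).
Notation mu := (@lebesgue_measure R).

Definition is_prior C lambda : Prop :=
  [/\ measurable_fun `[- C, C] lambda,
      forall m, m \in `[- C, C] -> 0 <= lambda m,
      \int[mu]_(m in `[- C, C]) lambda m = 1,
      0 < \int[mu]_(m in `[- C, 0]) (`|m| * lambda m) &
      0 < \int[mu]_(m in `[0, C]) (m * lambda m)].

Definition mean_loss (N M : nat) D C (P1 : probability (measurableTypeR R) R)
    lambda (sigma : strategy R) : R :=
  \int[mu]_(m in `[- C, C]) (loss M D P1 sigma m N * lambda m).

(* The minimum over all strategies exists and equals v. *)
Definition bayes_risk_is (N M : nat) D C
    (P1 : probability (measurableTypeR R) R) lambda (v : R) : Prop :=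
  minimum_of [set mean_loss N M D C P1 lambda sigma | sigma in setT] v.

Definition g1 D c rho x t : R :=
  \int[mu]_(w in `[0, c])
    (w * expR (D^-1 * (x * w - 2^-1 * t * w ^+ 2)) * rho w).

Definition g2 D c rho x t : R :=
  \int[mu]_(w in `[- c, 0])
    (`|w| * expR (D^-1 * (x * w - 2^-1 * t * w ^+ 2)) * rho w).

Definition grid_time eps t : Prop :=
  t <= 1 /\ exists j : nat, t = j%:R * eps.

Definition dp_equation eps D c rho (r r1 r2 : R -> R -> R) : Prop :=
  forall x t, grid_time eps t ->
    [/\ r x t = Num.min (r1 x t) (r2 x t),
        t = 1 -> r1 x t = 0 /\ r2 x t = 0 &
        t < 1 ->
          r1 x t = (1 - t) * g1 D c rho x t /\
          r2 x t = eps * g2 D c rho x t +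
            convolution (r ^~ (t + eps)) (gauss_density (eps * D) 0) x].

End bayes.

(* Main.v *)
(* The history enters only through the sequence of past actions and the
   cumulative income X of the unknown arm, so the law of a trajectory is an
   iterated operator [backup] on functions of (actions, X). A change of measure
   by the Gaussian likelihood exp (D^-1 (X m - n m^2 / 2)) turns every mean m
   into 0, and Tonelli then moves the integral over the prior inside: the mean
   loss of a strategy is the N-th iterate of [backup], at mean 0, of
   k G1 + n G2, where k, n count the actions and G1, G2 are the unnormalized
   posterior integrals of max(0, m) and max(0, -m). M steps of one batch
   collapse into a single Gaussian step of variance M D.

   G1 and G2 are martingales under this step. Hence a batch of the known arm
   may be postponed until the unknown arm is abandoned, so the stopping
   recursion of the statement, which never returns to the unknown arm, bounds
   every strategy from below; the strategy that stops when the first term of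
   the minimum is the smaller one attains it. Scaling m and X by N^(1/2)
   identifies the recursion with the given dynamic programming equation. *)
Require Import Defs.
From HB Require Import structures.
From mathcomp Require Import all_boot all_order all_algebra.
From mathcomp Require Import all_classical all_reals all_analysis.
From mathcomp Require Import measurable_realfun finmap ring lra.

Set Implicit Arguments.
Unset Strict Implicit.
Unset Printing Implicit Defensive.

Import Order.TTheory GRing.Theory Num.Theory.
Import numFieldNormedType.Exports.

Local Open Scope classical_set_scope.
Local Open Scope ring_scope.

(** * Integration against mixtures, densities and affine images *)

(** Signed incomes occur only up to the identity that turns the loss into the expected value of
    max(0, m) k + max(0, -m) n. From there on every integrand is nonnegative, so integrals stay in
    the extended reals and are exchanged by Tonelli. Finiteness is checked on returning to
    real-valued integrals, because [fine] sends an infinite value to 0 and would silently falsify an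
    equation. The cost is charged at the terminal state and not step by step: a change of measure
    then needs a single weight at the end, and the martingale property lets the accumulated cost be
    read again at any earlier state. The operators act on whole action lists and not on the pair (k,
    n), because inside a batch the last action decides the next one. The stopping recursion counts
    batches and charges each once, which is why a factor M stands in front of it and M V = N^(1/2) r
    is the final identification. The dynamic programming equation asserts no regularity of r;
    measurability and nonnegativity of r at grid times are inherited from the stopping value during
    the backward induction. *)

Section integral_functional.
Local Open Scope ereal_scope.
Import HBNNSimple.

(** The passage from indicators through simple functions to monotone limits, done once for an
    abstract functional [J]. Mixtures and laws with a density are then handled by checking the four
    closure properties. *)
Lemma integral_functionalE d (T : measurableType d) (R : realType)
    (nu : {measure set T -> \bar R}) (J : (T -> \bar R) -> \bar R) :
  (forall A, measurable A -> J (fun x => (\1_A x)%:E) = nu A) ->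
  (forall (k : R) f, (0 <= k)%R -> measurable_fun setT f -> (forall x, 0 <= f x) ->
    J (fun x => k%:E * f x) = k%:E * J f) ->
  (forall f g, measurable_fun setT f -> (forall x, 0 <= f x) ->
    measurable_fun setT g -> (forall x, 0 <= g x) ->
    J (f \+ g) = J f + J g) ->
  (forall f_ : (T -> \bar R)^nat, (forall n, measurable_fun setT (f_ n)) ->
    (forall n x, 0 <= f_ n x) -> (forall x, nondecreasing_seq (f_ ^~ x)) ->
    J (fun x => limn (f_ ^~ x)) = limn (fun n => J (f_ n))) ->
  forall f, measurable_fun setT f -> (forall x, 0 <= f x) ->
  \int[nu]_x f x = J f.
Proof.
move=> Jindic JZ JD Jlim.
have J0 : J (cst 0) = 0.
  have J0E : (cst 0 : T -> \bar R) = fun x => (\1_(@set0 T) x)%:E.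
    by rewrite indic0.
  by rewrite J0E Jindic// measure0.
have Jnnsfun (g : {nnsfun T >-> R}) :
    \int[nu]_x (g x)%:E = J (fun x => (g x)%:E).
  have gE x : (g x)%:E = \sum_(y <- fset_set (range g))
      (y%:E * (\1_(g @^-1` [set y]) x)%:E).
    rewrite [in LHS]fimfunE fsbig_finite//= -sumEFin.
    by apply: eq_bigr => i _; rewrite EFinM.
  under eq_integral do rewrite gE.
  under [in RHS]eq_fun do rewrite gE.
  have ge0 y : y \in fset_set (range g) -> (0 <= y)%R.
    by rewrite in_fset_set// => /set_mem[x _ <-]; exact: fun_ge0.
  (* The induction runs over arbitrary sublists of the range of [g]; the inclusion keeps all
     coefficients nonnegative, as homogeneity and additivity of [J] require. *)
  pose S (s : seq R) x := \sum_(y <- s) (y%:E * (\1_(g @^-1` [set y]) x)%:E).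
  suff H0 (s : seq R) : {subset s <= fset_set (range g)} ->
      \int[nu]_x S s x = J (S s) by exact: H0.
  elim: s => [|y s IH] ss.
    rewrite (_ : S [::] = cst 0); first by rewrite integral0 J0.
    by apply/funext => x; rewrite /S big_nil.
    have y0 : (0 <= y)%R by apply: ge0; apply: ss; rewrite mem_head.
    have ms : measurable_fun setT (S s).
      by apply: emeasurable_sum => z; apply: emeasurable_funM => //;
         exact/measurable_EFinP.
    have s0 x : 0 <= S s x.
      rewrite /S big_seq; apply: sume_ge0 => z zs; rewrite mule_ge0// lee_fin//.
      by apply/ge0/ss; rewrite inE zs orbT.
    have my : measurable_fun setT (fun x : T => (\1_(g @^-1` [set y]) x)%:E : \bar R).
      exact/measurable_EFinP.
    have -> : S (y :: s) = (fun x => y%:E * (\1_(g @^-1` [set y]) x)%:E) \+ S s.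
      by apply/funext => x; rewrite /S big_cons.
    rewrite ge0_integralD//; last 2 first.
    - by move=> x _; rewrite mule_ge0// lee_fin.
    - exact: emeasurable_funM.
    rewrite JD//; last 2 first.
    - exact: emeasurable_funM.
    - by move=> x; rewrite mule_ge0// lee_fin.
    rewrite IH; last by move=> z zs; apply: ss; rewrite inE zs orbT.
    by rewrite JZ// Jindic// ge0_integralZl// integral_indic// setIT.
move=> f mf f0; pose f_ := nnsfun_approx measurableT mf.
transitivity (limn (fun n => \int[nu]_x (f_ n x)%:E)).
  rewrite -monotone_convergence//.
  - by apply: eq_integral => x _; apply/esym/cvg_lim => //; exact: cvg_nnsfun_approx.
  - by move=> n; exact/measurable_EFinP.
  - by move=> n x _; rewrite lee_fin.
  - by move=> x _ m n mn; rewrite lee_fin; exact/lefP/nd_nnsfun_approx.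
under eq_fun do rewrite Jnnsfun.
rewrite -Jlim//.
- congr J; apply/funext => x; apply/cvg_lim => //; exact: cvg_nnsfun_approx.
- by move=> n; exact/measurable_EFinP.
- by move=> n x; rewrite lee_fin.
- by move=> x m n mn; rewrite lee_fin; exact/lefP/nd_nnsfun_approx.
Qed.

End integral_functional.

(** The disintegration formula. The closure under limits uses monotone convergence twice, once under
    each [K x] and once under [P]. *)
Lemma ge0_integral_kernel_bind d1 d2 (X : measurableType d1)
    (Y : measurableType d2) (R : realType) (P : probability X R)
    (K : R.-pker X ~> Y) (f : Y -> \bar R) :
  measurable_fun setT f -> (forall y, 0 <= f y)%E ->
  (\int[kernel_bind P K]_y f y = \int[P]_x \int[K x]_y f y)%E.
Proof.
have mK (g : Y -> \bar R) : measurable_fun setT g -> (forall y, 0 <= g y)%E ->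
    measurable_fun setT (fun x => \int[K x]_y g y)%E.
  move=> mg g0; apply: measurable_fun_integral_kernel => //.
  by move=> U mU; exact: measurable_kernel.
have K0 (g : Y -> \bar R) : (forall y, 0 <= g y)%E ->
    forall x, (0 <= \int[K x]_y g y)%E.
  by move=> g0 x; exact: integral_ge0.
apply: (integral_functionalE (J := fun f => (\int[P]_x \int[K x]_y f y)%E)).
- move=> A mA; apply: eq_integral => x _.
  by rewrite integral_indic// setIT.
- move=> k g k0 mg g0.
  under eq_integral do rewrite ge0_integralZl//.
  by rewrite ge0_integralZl//; [exact: mK|move=> x _; exact: K0].
- move=> g h mg g0 mh h0.
  under eq_integral do rewrite ge0_integralD//.
  by rewrite ge0_integralD//; [move=> x _; exact: K0|exact: mK|
    move=> x _; exact: K0|exact: mK].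
- move=> g mg g0 ndg.
  transitivity (\int[P]_x limn (fun n => \int[K x]_y g n y))%E.
    by apply: eq_integral => x _; rewrite monotone_convergence// => y _; exact: ndg.
  rewrite monotone_convergence//.
  - by move=> n; exact: mK.
  - by move=> n x _; exact: K0.
  - move=> x _ m n mn; apply: ge0_le_integral => //.
    by move=> y _; exact: ndg.
Qed.

Lemma ge0_integral_normal_prob (R : realType) (m s : R)
    (f : measurableTypeR R -> \bar R) :
  measurable_fun setT f -> (forall x, 0 <= f x)%E ->
  (\int[normal_prob m s]_x f x =
   \int[lebesgue_measure]_x (f x * (normal_pdf m s x)%:E))%E.
Proof.
have p0 x : (0 <= (normal_pdf m s x)%:E)%E by rewrite lee_fin normal_pdf_ge0.
have mp : measurable_fun setT (fun x => (normal_pdf m s x)%:E).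
  by apply/measurable_EFinP; exact: measurable_normal_pdf.
apply: (integral_functionalE
  (J := fun f => (\int[lebesgue_measure]_x (f x * (normal_pdf m s x)%:E))%E)).
- move=> A mA; rewrite /normal_prob/= [RHS]integral_mkcond.
  apply: eq_integral => x _; rewrite patchE indicE.
  by case: (x \in A); rewrite ?mul1e ?mul0e.
- move=> k g k0 mg g0.
  under eq_integral do rewrite -muleA.
  rewrite ge0_integralZl//; first exact: emeasurable_funM.
  by move=> x _; rewrite mule_ge0.
- move=> g h mg g0 mh h0.
  under eq_integral do rewrite ge0_muleDl//.
  by rewrite ge0_integralD//; [move=> x _; rewrite mule_ge0|
    exact: emeasurable_funM|move=> x _; rewrite mule_ge0|
    exact: emeasurable_funM].
- move=> g mg g0 ndg.
  transitivity (\int[lebesgue_measure]_x limn (fun n => g n x * (normal_pdf m s x)%:E))%E.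
    apply: eq_integral => x _; apply/esym/cvg_lim => //.
    apply: cvgeMr => //; apply: ereal_nondecreasing_is_cvgn; exact: ndg.
  rewrite monotone_convergence//.
  - by move=> n; exact: emeasurable_funM.
  - by move=> n x _; rewrite mule_ge0.
  - by move=> x _ a b ab; rewrite lee_wpmul2r//; exact: ndg.
Qed.

Section affine_change_of_variables.
Local Open Scope ereal_scope.
Context (R : realType).
Notation mu := (@lebesgue_measure R).

(** By uniqueness of Lebesgue measure: the image of [mu] under x -> a x + b, scaled by [a], gives
    half-open intervals their length, hence equals [mu]. *)
Lemma ge0_integral_affine (a b : R) (f : measurableTypeR R -> \bar R) :
  (0 < a)%R -> measurable_fun setT f -> (forall x, 0 <= f x) ->
  a%:E * \int[mu]_x f (a * x + b)%R = \int[mu]_x f x.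
Proof.
move=> a0 mf f0.
pose phi (x : measurableTypeR R) : measurableTypeR R := (a * x + b)%R.
have mphi : measurable_fun setT phi.
  by apply: measurable_funD => //; exact: measurable_funM.
have a0' : (0 <= a)%R by exact: ltW.
have muE A : measurable A -> mu A = mscale (NngNum a0') (pushforward mu phi) A.
  apply: lebesgue_measure_unique => //= _ [[u v]] _ <-.
  rewrite /mscale/= /pushforward.
  rewrite (_ : phi @^-1` `]u, v] = `](u - b) / a, (v - b) / a]%classic)%R.
    rewrite !lebesgue_measure_itv/= !lte_fin.
    rewrite ltr_pM2r ?invr_gt0// ltrD2r; case: ifPn => _; last by rewrite mule0.
    by rewrite -!EFinB -EFinM -mulrBl mulrCA divff ?mulr1 ?gt_eqF//; congr EFin;
      rewrite opprB addrA subrK.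
  apply/seteqP; split => x /=; rewrite !in_itv/= /phi;
    by rewrite ltr_pdivrMr// ler_pdivlMr// ltrBlDr lerBrDr (mulrC x).
rewrite [RHS](eq_measure_integral (mscale (NngNum a0') (pushforward mu phi))).
  by rewrite ge0_integral_mscale//= ge0_integral_pushforward.
by move=> A mA _; exact: muE.
Qed.

Lemma ge0_integral_oppr (f : measurableTypeR R -> \bar R) :
  measurable_fun setT f -> (forall x, 0 <= f x) ->
  \int[mu]_x f (- x)%R = \int[mu]_x f x.
Proof.
move=> mf f0.
have -> : \int[mu]_x f x =
    \int[pushforward mu (-%R : _ -> measurableTypeR R)]_x f x.
  by apply: eq_measure_integral => A mA _; exact/esym/lebesgue_measureN.
by rewrite ge0_integral_pushforward.
Qed.

End affine_change_of_variables.

(** * Gaussian laws *)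

Section gaussian.
Context (R : realType).
Implicit Types (V W a x y z : R).
Notation mu := (@lebesgue_measure R).

(* At [V = 0] this is not a Dirac mass but the junk value of [normal_prob]. *)
Definition gauss V : probability (measurableTypeR R) R :=
  normal_prob 0 (Num.sqrt V).

Lemma gauss_density_ge0 V a x : 0 <= gauss_density V a x.
Proof. exact: normal_pdf_ge0. Qed.

Lemma measurable_gauss_density V a :
  measurable_fun [set: measurableTypeR R] (gauss_density V a).
Proof. exact: measurable_normal_pdf. Qed.

Lemma integral_gauss_density V a :
  (\int[mu]_x (gauss_density V a x)%:E = 1)%E.
Proof. exact: integral_normal_pdf. Qed.

Lemma ge0_integral_gauss V (f : measurableTypeR R -> \bar R) :
  measurable_fun setT f -> (forall x, 0 <= f x)%E ->
  (\int[gauss V]_x f x = \int[mu]_x (f x * (gauss_density V 0 x)%:E))%E.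
Proof. exact: ge0_integral_normal_prob. Qed.

(** Completing the square. This exponential tilt is the origin of the likelihood ratio used for the
    change of measure. *)
Lemma gauss_density_tilt V a x : 0 < V ->
  gauss_density V a x =
  gauss_density V 0 x * expR (V^-1 * (a * x - 2^-1 * a ^+ 2)).
Proof.
move=> V0; rewrite !gauss_densityE// -[RHS]mulrA -expRD; congr (_ * expR _).
by field; rewrite gt_eqF.
Qed.

(** The joint density of two independent centered normal variables at (y, z - y), factored as the
    density of their sum z times the conditional density of y given z, which has mean z V / (V + W)
    and variance V W / (V + W). *)
Lemma gauss_densityM V W y z : 0 < V -> 0 < W ->
  gauss_density V 0 y * gauss_density W 0 (z - y) =
  gauss_density (V + W) 0 z *
    gauss_density (V * W / (V + W)) (z * V / (V + W)) y.
Proof.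
move=> V0 W0; have VW0 : 0 < V + W by rewrite addr_gt0.
have U0 : 0 < V * W / (V + W) by rewrite divr_gt0// mulr_gt0.
have pi2 : 0 <= 2 * pi :> R by rewrite mulr_ge0// pi_ge0.
rewrite !gauss_densityE// mulrACA [RHS]mulrACA -!expRD -!invfM.
have p0 (v : R) : 0 < v -> 0 <= 2 * pi * v.
  by move=> v0; exact: mulr_ge0 pi2 (ltW v0).
rewrite -!sqrtrM ?p0//.
congr (_ * expR _); last by field; rewrite !gt_eqF.
by congr (Num.sqrt _)^-1; field; rewrite gt_eqF.
Qed.

Lemma gauss_densityZ (k V x : R) : 0 < k -> 0 < V ->
  k * gauss_density (k ^+ 2 * V) 0 (k * x) = gauss_density V 0 x.
Proof.
move=> k0 V0; rewrite !gauss_densityE ?mulr_gt0 ?exprn_gt0//.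
have -> : 2 * pi * (k ^+ 2 * V) = k ^+ 2 * (2 * pi * V) by ring.
rewrite sqrtrM ?sqr_ge0// sqrtr_sqr gtr0_norm// invfM !mulrA divff ?gt_eqF//.
by rewrite mul1r; congr (_ * expR _); field; rewrite !gt_eqF.
Qed.

Local Open Scope ereal_scope.

Lemma ge0_integral_gauss_opp V (f : measurableTypeR R -> \bar R) :
  (0 < V)%R -> measurable_fun setT f -> (forall x, 0 <= f x) ->
  \int[gauss V]_x f (- x)%R = \int[gauss V]_x f x.
Proof.
move=> V0 mf f0.
have mfN : measurable_fun setT (fun x : measurableTypeR R => f (- x)%R).
  by apply: (measurableT_comp mf); exact: oppr_measurable.
have fN0 x : 0 <= f (- x)%R by [].
rewrite [LHS](ge0_integral_gauss _ mfN fN0) [RHS](ge0_integral_gauss _ mf f0).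
have mh : measurable_fun setT
    (fun x : measurableTypeR R => f x * (gauss_density V 0 x)%:E).
  apply: emeasurable_funM => //; apply/measurable_EFinP.
  exact: measurable_gauss_density.
have h0 x : 0 <= f x * (gauss_density V 0 x)%:E.
  by rewrite mule_ge0// lee_fin gauss_density_ge0.
rewrite -[RHS](ge0_integral_oppr mh h0).
apply: eq_integral => x _; congr (_ * _%:E)%E.
by rewrite !gauss_densityE// !subr0 sqrrN.
Qed.

Lemma ge0_integral_gaussZ (k V : R) (f : measurableTypeR R -> \bar R) :
  (0 < k)%R -> (0 < V)%R -> measurable_fun setT f -> (forall x, 0 <= f x) ->
  \int[gauss (k ^+ 2 * V)]_x f x = \int[gauss V]_x f (k * x)%R.
Proof.
move=> k0 V0 mf f0.
have mfk : measurable_fun setT (fun x : measurableTypeR R => f (k * x)%R).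
  by apply: (measurableT_comp mf); exact: measurable_funM.
have fk0 x : 0 <= f (k * x)%R by [].
rewrite [LHS](ge0_integral_gauss _ mf f0) [RHS](ge0_integral_gauss _ mfk fk0).
have mg W : measurable_fun setT (fun x : measurableTypeR R => (gauss_density W 0 x)%:E).
  by apply/measurable_EFinP; exact: measurable_gauss_density.
have mg' W : measurable_fun setT (fun x : measurableTypeR R => (gauss_density W 0 (k * x))%:E).
  by apply: (measurableT_comp (mg W)); exact: measurable_funM.
have mh : measurable_fun setT
    (fun x : measurableTypeR R => f x * (gauss_density (k ^+ 2 * V) 0 x)%:E).
  exact: emeasurable_funM.
have h0 x : 0 <= f x * (gauss_density (k ^+ 2 * V) 0 x)%:E.
  by rewrite mule_ge0// lee_fin gauss_density_ge0.
rewrite -[LHS](ge0_integral_affine 0%R k0 mh h0).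
have mhk : measurable_fun setT (fun x : measurableTypeR R =>
    f (k * x)%R * (gauss_density (k ^+ 2 * V) 0 (k * x))%:E).
  by apply: emeasurable_funM => //; exact: mg'.
under eq_integral do rewrite addr0.
transitivity (\int[mu]_x (k%:E *
    (f (k * x)%R * (gauss_density (k ^+ 2 * V) 0 (k * x))%:E))).
  by rewrite ge0_integralZl ?lee_fin ?(ltW k0).
by apply: eq_integral => x _; rewrite muleCA -EFinM gauss_densityZ.
Qed.

(** After Tonelli the inner integral over y is that of the conditional density of [gauss_densityM],
    which is 1. This is what merges the steps of a batch. *)
Lemma ge0_integral_gaussD V W (f : measurableTypeR R -> \bar R) :
  (0 < V)%R -> (0 < W)%R -> measurable_fun setT f -> (forall x, 0 <= f x) ->
  \int[gauss V]_y \int[gauss W]_x f (y + x)%R = \int[gauss (V + W)]_z f z.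
Proof.
move=> V0 W0 mf f0.
have mg U a : measurable_fun setT (fun x : measurableTypeR R => (gauss_density U a x)%:E).
  by apply/measurable_EFinP; exact: measurable_gauss_density.
have g0 U a x : 0 <= (gauss_density U a x)%:E by rewrite lee_fin gauss_density_ge0.
have mD (y : R) : measurable_fun setT (fun x : measurableTypeR R => f (y + x)%R).
  by apply: (measurableT_comp mf); exact: measurable_funD.
have mB : measurable_fun setT
    (fun p : measurableTypeR R * measurableTypeR R => (p.2 - p.1)%R : measurableTypeR R).
  exact: measurable_funB.
have mh : measurable_fun setT (fun p : measurableTypeR R * measurableTypeR R =>
    (gauss_density V 0 p.1)%:E * (f p.2 * (gauss_density W 0 (p.2 - p.1))%:E)).
  apply: emeasurable_funM; first exact: (measurableT_comp (mg V 0%R)).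
  apply: emeasurable_funM; first exact: (measurableT_comp mf).
  exact: (measurableT_comp (mg W 0%R) mB).
have h0 p : 0 <= (gauss_density V 0 p.1)%:E * (f p.2 * (gauss_density W 0 (p.2 - p.1))%:E).
  by rewrite !mule_ge0.
have inner y : \int[gauss W]_x f (y + x)%R =
    \int[mu]_z (f z * (gauss_density W 0 (z - y))%:E).
  rewrite (ge0_integral_gauss _ (mD y) (fun _ => f0 _)).
  have mk : measurable_fun setT
      (fun z : measurableTypeR R => f z * (gauss_density W 0 (z - y))%:E).
    apply: emeasurable_funM => //; apply: (measurableT_comp (mg W 0%R)).
    exact: measurable_funB.
  have k0 z : 0 <= f z * (gauss_density W 0 (z - y))%:E by rewrite mule_ge0.
  rewrite -[RHS](ge0_integral_affine y (@ltr01 R) mk k0).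
  by rewrite mul1e; apply: eq_integral => x _; rewrite mul1r addrK addrC.
transitivity (\int[mu]_y \int[mu]_z
    ((gauss_density V 0 y)%:E * (f z * (gauss_density W 0 (z - y))%:E))).
  have mi : measurable_fun setT (fun y : measurableTypeR R =>
      \int[mu]_z (f z * (gauss_density W 0 (z - y))%:E)).
    apply: (measurable_fun_fubini_tonelli_F (m2 := mu)
        (fun p : measurableTypeR R * measurableTypeR R =>
        f p.2 * (gauss_density W 0 (p.2 - p.1))%:E)).
    - apply: emeasurable_funM; first exact: (measurableT_comp mf).
      exact: (measurableT_comp (mg W 0%R) mB).
    - by move=> p; rewrite mule_ge0.
  under eq_integral do rewrite inner.
  have i0 y : 0 <= \int[mu]_z (f z * (gauss_density W 0 (z - y))%:E).
    by apply: integral_ge0 => z _; rewrite mule_ge0.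
  rewrite (ge0_integral_gauss _ mi i0).
  apply: eq_integral => y _; rewrite muleC ge0_integralZl//.
  - apply: emeasurable_funM => //; apply: (measurableT_comp (mg W 0%R)).
    exact: measurable_funB.
  - by move=> z _; rewrite mule_ge0.
transitivity (\int[mu]_z \int[mu]_y
    ((gauss_density V 0 y)%:E * (f z * (gauss_density W 0 (z - y))%:E))).
  exact: (fubini_tonelli _ mh h0).
rewrite (ge0_integral_gauss _ mf f0); apply: eq_integral => z _ /=.
under eq_integral do rewrite muleCA -EFinM gauss_densityM// EFinM muleA.
rewrite ge0_integralZl//; last by rewrite mule_ge0.
by rewrite integral_gauss_density mule1.
Qed.

End gaussian.

(** * Trajectory laws as iterated operators *)

Section state.
Context (R : realType).
Notation trajectory i := (i.-tuple (bool * R)%type).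
Implicit Types (a : seq bool) (X : R) (phi psi : seq bool -> R -> \bar R).

(** [prob2] read on the reduced state. The order of the actions is kept because of the last one;
    incomes of the known arm are forgotten. *)
Definition next_prob2 (M : nat) (sigma : strategy R) a X : R :=
  if (M %| count negb a)%N && (M %| count id a)%N
  then select2 sigma (count negb a) X (count id a)
  else (last false a : bool)%:R.

Lemma prob2E M sigma (h : seq (bool * R)) :
  prob2 M sigma h = next_prob2 M sigma (map fst h) (income2 h).
Proof.
rewrite /prob2 /next_prob2 /count1 /count2 !count_map.
by rewrite (last_map fst h (false, 0%R)).
Qed.

Lemma next_prob2_01 M sigma a X : 0 <= next_prob2 M sigma a X <= 1.
Proof.
rewrite /next_prob2; case: ifP => _; first exact: select2_01.
by case: (last _ _); rewrite /= ?lexx ?ler01.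
Qed.

Lemma measurable_next_prob2 M sigma a :
  measurable_fun [set: R] (next_prob2 M sigma a).
Proof.
by rewrite /next_prob2; case: (_ && _) => //; exact: measurable_select2.
Qed.

Definition nneg_measurable phi :=
  forall a, measurable_fun [set: R] (phi a) /\ forall X, (0 <= phi a X)%E.

(** The finitely many action sequences cut the trajectory space into measurable cells, and on each
    cell the function is a measurable function of the income alone. *)
Lemma measurable_state i phi : (forall a, measurable_fun [set: R] (phi a)) ->
  measurable_fun setT (fun h : trajectory i => phi (map fst h) (income2 h)).
Proof.
move=> mphi _ Y mY; rewrite setTI.
have -> : (fun h : trajectory i => phi (map fst h) (income2 h)) @^-1` Y =
    \bigcup_(b : i.-tuple bool)
      ((\bigcap_(j : 'I_i) ((fun h : trajectory i => (tnth h j).1) @^-1` [set tnth b j]))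
       `&` ((fun h : trajectory i => phi b (income2 h)) @^-1` Y)).
  apply/seteqP; split => h /=.
    move=> Yh; exists [tuple of map fst h] => //; split => //.
    by move=> j _ /=; rewrite (tnth_map fst).
  move=> [b _ [/= hb]]; suff -> : tval b = map fst h by [].
  suff -> : b = [tuple of map fst h] by [].
  by apply: eq_from_tnth => j; rewrite (tnth_map fst) -(hb j).
apply: fin_bigcup_measurable; first exact: finite_finset.
move=> b _; apply: measurableI.
  apply: fin_bigcap_measurable => [|j _]; first exact: finite_finset.
  by rewrite -[X in measurable X]setTI; exact: measurable_fst_tnth.
rewrite -[X in measurable X]setTI.
by apply: (measurableT_comp (mphi b) (@measurable_income2 R i)).
Qed.

Context (M : nat) (D : R) (sigma : strategy R).

(** The one-step transition operator: the expectation of [phi] after the next step. [P1] disappears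
    because incomes of the known arm do not enter the state. *)
Definition backup (m : R) phi a X : \bar R :=
  ((next_prob2 M sigma a X)%:E *
     \int[normal_prob m (Num.sqrt D)]_x phi (rcons a true) (X + x)%R +
   (1 - next_prob2 M sigma a X)%:E * phi (rcons a false) X)%E.

Lemma measurable_integral_shift (P : probability (measurableTypeR R) R)
    (f : R -> \bar R) :
  measurable_fun [set: R] f -> (forall x, 0 <= f x)%E ->
  measurable_fun [set: R] (fun X => \int[P]_x f (X + x)%R)%E.
Proof.
move=> mf f0.
apply: (measurable_fun_fubini_tonelli_F (m2 := P)
  (fun p : measurableTypeR R * measurableTypeR R => f (p.1 + p.2))) => //.
by apply: (measurableT_comp mf); exact: measurable_funD.
Qed.

Lemma onem_next_prob2_ge0 a X : 0 <= 1 - next_prob2 M sigma a X.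
Proof. by rewrite subr_ge0; case/andP: (next_prob2_01 M sigma a X). Qed.

Lemma next_prob2_ge0 a X : 0 <= next_prob2 M sigma a X.
Proof. by case/andP: (next_prob2_01 M sigma a X). Qed.

Lemma nneg_measurable_backup m phi :
  nneg_measurable phi -> nneg_measurable (backup m phi).
Proof.
move=> phiP a; split.
  apply: emeasurable_funD; apply: emeasurable_funM.
  - by apply/measurable_EFinP; exact: measurable_next_prob2.
  - by case: (phiP (rcons a true)) => mf f0; exact: measurable_integral_shift.
  - apply/measurable_EFinP; apply: measurable_funB => //.
    exact: measurable_next_prob2.
  - by case: (phiP (rcons a false)).
move=> X; rewrite /backup adde_ge0// mule_ge0 ?lee_fin ?next_prob2_ge0//
  ?onem_next_prob2_ge0//; last by case: (phiP (rcons a false)).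
by apply: integral_ge0 => x _; case: (phiP (rcons a true)).
Qed.

Context (P1 : probability (measurableTypeR R) R).

Lemma income2_rcons (h : seq (bool * R)) e :
  income2 (rcons h e) = income2 h + (if e.1 then e.2 else 0).
Proof.
by rewrite /income2 -cats1 big_cat/= big_cons big_nil; case: ifP; rewrite !addr0.
Qed.

Lemma integral_step m i (h : trajectory i) (f : trajectory i.+1 -> \bar R) :
  measurable_fun setT f -> (forall h, 0 <= f h)%E ->
  (\int[step M D P1 sigma m h]_h' f h' =
    (prob2 M sigma h)%:E *
      \int[normal_prob m (Num.sqrt D)]_x f (extend h true x) +
    (1 - prob2 M sigma h)%:E * \int[P1]_x f (extend h false x))%E.
Proof.
move=> mf f0.
rewrite ge0_integral_kernel_bind// integral_bernoulli_prob ?prob2_01//; last first.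
  by move=> y; exact: integral_ge0.
by rewrite /arm_step !ge0_integral_distribution.
Qed.

Lemma integral_step_state m i (h : trajectory i) phi : nneg_measurable phi ->
  (\int[step M D P1 sigma m h]_h' phi (map fst h') (income2 h') =
   backup m phi (map fst h) (income2 h))%E.
Proof.
move=> phiP; rewrite integral_step; last 2 first.
- by apply: measurable_state => a; case: (phiP a).
- by move=> h'; case: (phiP (map fst h')).
rewrite prob2E /backup; congr (_ * _ + _ * _)%E.
  by apply: eq_integral => x _; rewrite map_rcons income2_rcons.
under eq_integral do rewrite /= map_rcons income2_rcons/= addr0.
rewrite integral_cst// -[RHS]mule1; congr (_ * _)%E; exact: probability_setT.
Qed.

Lemma integral_trajectory_law m i phi : nneg_measurable phi ->
  (\int[trajectory_law M D P1 sigma m i]_h phi (map fst h) (income2 h) =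
   iter i (backup m) phi [::] 0%R)%E.
Proof.
elim: i phi => [|i IH] phi phiP.
  rewrite /= integral_dirac//; last first.
    by apply: measurable_state => a; case: (phiP a).
  by rewrite diracT mul1e /income2 big_nil.
(* The law loses its last step, so the matching [backup] is the innermost one, applied directly to
   [phi]. *)
rewrite iterSr -IH; last exact: nneg_measurable_backup.
rewrite ge0_integral_kernel_bind//; last 2 first.
- by apply: measurable_state => a; case: (phiP a).
- by move=> h'; case: (phiP (map fst h')).
by apply: eq_integral => h _; exact: integral_step_state.
Qed.

End state.

(** * Loss of a strategy *)

Section signed_integrals.
Local Open Scope ereal_scope.

Lemma integral_kernel_bind d1 d2 (X : measurableType d1)
    (Y : measurableType d2) (R : realType) (P : probability X R)
    (K : R.-pker X ~> Y) (f : Y -> \bar R) :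
  (kernel_bind P K).-integrable setT f ->
  \int[kernel_bind P K]_y f y = \int[P]_x \int[K x]_y f y.
Proof.
move=> intf; have mf := measurable_int _ intf.
have mfp := measurable_funepos mf; have mfn := measurable_funeneg mf.
have mK (g : Y -> \bar R) : measurable_fun setT g -> (forall y, 0 <= g y) ->
    measurable_fun setT (fun x => \int[K x]_y g y).
  move=> mg g0; apply: measurable_fun_integral_kernel => //.
  by move=> U mU; exact: measurable_kernel.
have intK (g : Y -> \bar R) : measurable_fun setT g -> (forall y, 0 <= g y) ->
    \int[kernel_bind P K]_y g y \is a fin_num ->
    P.-integrable setT (fun x => \int[K x]_y g y).
  move=> mg g0 gfin; apply/integrableP; split; first exact: mK.
  rewrite (eq_integral (fun x => \int[K x]_y g y)); last first.
    by move=> x _; rewrite gee0_abs//; exact: integral_ge0.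
  by rewrite -ge0_integral_kernel_bind// ltey_eq gfin.
have intp := intK _ mfp (fun _ => funepos_ge0 _ _) (integrable_pos_fin_num measurableT intf).
have intn := intK _ mfn (fun _ => funeneg_ge0 _ _) (integrable_neg_fin_num measurableT intf).
rewrite integralE !ge0_integral_kernel_bind// -integralB//.
by apply: eq_integral => x _; rewrite [RHS]integralE.
Qed.

Lemma ge0_integral_normal_shift (R : realType) (m V : R)
    (f : measurableTypeR R -> \bar R) : (0 < V)%R ->
  measurable_fun setT f -> (forall x, 0 <= f x) ->
  \int[normal_prob m (Num.sqrt V)]_x f x = \int[gauss V]_x f (x + m)%R.
Proof.
move=> V0 mf f0.
have mfm : measurable_fun setT (fun x : measurableTypeR R => f (x + m)%R).
  by apply: (measurableT_comp mf); exact: measurable_funD.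
rewrite [LHS](ge0_integral_normal_prob _ _ mf f0).
rewrite [RHS](ge0_integral_gauss _ mfm (fun=> f0 _)).
have mh : measurable_fun setT
    (fun x : measurableTypeR R => f x * (normal_pdf m (Num.sqrt V) x)%:E).
  apply: emeasurable_funM => //; apply/measurable_EFinP.
  exact: measurable_normal_pdf.
have h0 x : 0 <= f x * (normal_pdf m (Num.sqrt V) x)%:E.
  by rewrite mule_ge0// lee_fin normal_pdf_ge0.
rewrite -[LHS](ge0_integral_affine m (@ltr01 R) mh h0) mul1e.
apply: eq_integral => x _; rewrite mul1r; congr (_ * _%:E).
rewrite -!/(gauss_density _ _ _) !gauss_densityE//.
by congr (_ * expR _)%R; field; rewrite gt_eqF.
Qed.

(** By |x| <= e^x + e^(-x), where both exponentials have the finite expectation e^(V/2). *)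
Lemma integral_abs_gauss_fin (R : realType) (V : R) : (0 < V)%R ->
  \int[gauss V]_x `|x : R|%:E < +oo.
Proof.
move=> V0.
have mE : measurable_fun setT (fun x : measurableTypeR R => (expR x)%:E).
  by apply/measurable_EFinP; exact: measurable_expR.
have mEN : measurable_fun setT (fun x : measurableTypeR R => (expR (- x))%:E).
  by apply: (measurableT_comp mE); exact: oppr_measurable.
have E0 x : 0 <= (expR x)%:E :> \bar R by rewrite lee_fin expR_ge0.
have intE : \int[gauss V]_x (expR (x : R))%:E = (expR (V / 2))%:E.
  rewrite (ge0_integral_gauss _ mE E0).
  (* Tilting with mean [V]: e^x times the centered density is e^(V/2) times the density centered at
     [V], whose mass is 1. *)
  transitivity (\int[lebesgue_measure]_x ((expR (V / 2))%:E * (gauss_density V V x)%:E)).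
    apply: eq_integral => x _.
    rewrite [gauss_density V V x]gauss_density_tilt// -!EFinM; congr EFin.
    rewrite [LHS]mulrC [RHS]mulrCA -expRD; congr (_ * expR _)%R.
    by field; rewrite gt_eqF.
  rewrite ge0_integralZl//.
  - by rewrite integral_gauss_density mule1.
  - by apply/measurable_EFinP; exact: measurable_gauss_density.
  - by move=> x _; rewrite lee_fin gauss_density_ge0.
have intEN : \int[gauss V]_x (expR (- (x : R)))%:E = (expR (V / 2))%:E.
  by rewrite (ge0_integral_gauss_opp V0 mE E0).
apply: (@le_lt_trans _ _ (\int[gauss V]_x ((expR (x : R))%:E + (expR (- (x : R)))%:E))).
  apply: ge0_le_integral => //.
  - apply/measurable_EFinP; exact: (@normr_measurable R setT).

  - exact: emeasurable_funD.
  - move=> x _; rewrite -EFinD lee_fin.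
    have h (y : R) : (y <= expR y)%R.
      by apply: le_trans (expR_ge1Dx y); rewrite lerDr.
    have := h x; have := h (- x)%R.
    have := expR_ge0 x; have := expR_ge0 (- x)%R.
    by rewrite ler_norml => *; apply/andP; split; lra.
by rewrite ge0_integralD// intE intEN -EFinD ltry.
Qed.

Section normal_mean.
Context (R : realType) (m V : R).
Hypothesis V0 : (0 < V)%R.

Lemma integral_centered_normal_fin :
  \int[normal_prob m (Num.sqrt V)]_x `|(x : R) - m|%:E < +oo.
Proof.
have mf : measurable_fun setT (fun x : measurableTypeR R => `|x - m|%:E).
  apply/measurable_EFinP; apply: (measurableT_comp (@normr_measurable R setT)).
  exact: measurable_funB.
rewrite (ge0_integral_normal_shift _ V0 mf) => [|x]; last by rewrite lee_fin.
under eq_integral do rewrite addrK.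
exact: integral_abs_gauss_fin.
Qed.

(** By symmetry the positive and the negative part have the same integral; it is finite, so the
    difference is a genuine 0. *)
Lemma integral_centered_normal :
  \int[normal_prob m (Num.sqrt V)]_x ((x : R) - m)%:E = 0.
Proof.
have mf : measurable_fun setT (fun x : measurableTypeR R => (x - m)%:E).
  by apply/measurable_EFinP; exact: measurable_funB.
have mg : measurable_fun setT (fun x : measurableTypeR R => (x : R)%:E).
  exact/measurable_EFinP.
rewrite integralE.
rewrite (ge0_integral_normal_shift m V0 (measurable_funepos mf) (fun=> funepos_ge0 _ _)).
rewrite (ge0_integral_normal_shift m V0 (measurable_funeneg mf) (fun=> funeneg_ge0 _ _)).
have -> : \int[gauss V]_x (fun x : R => (x - m)%:E)^\+ (x + m)%R =
    \int[gauss V]_x (fun x : R => x%:E)^\+ x.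
  by apply: eq_integral => x _; rewrite !funeposE addrK.
have -> : \int[gauss V]_x (fun x : R => (x - m)%:E)^\- (x + m)%R =
    \int[gauss V]_x (fun x : R => x%:E)^\+ x.
  rewrite -[RHS](ge0_integral_gauss_opp V0 (measurable_funepos mg) (fun=> funepos_ge0 _ _)).
  by apply: eq_integral => x _; rewrite funenegE funeposE addrK.
rewrite subee// fin_numE; apply/andP; split.
  by rewrite gt_eqF// (lt_le_trans ltNy0)//; apply: integral_ge0 => x _; exact: funepos_ge0.
rewrite lt_eqF// (le_lt_trans _ (integral_abs_gauss_fin V0))//.
apply: ge0_le_integral => //.
- exact: measurable_funepos.
- apply/measurable_EFinP; exact: (@normr_measurable R setT).
- by move=> x _; rewrite funeposE ge_max !lee_fin ler_norm normr_ge0.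
Qed.

End normal_mean.

End signed_integrals.

(** * The loss at a fixed mean as a nonnegative expected cost *)

Section loss.
Local Open Scope ereal_scope.
Context (R : realType) (M : nat) (D : R) (sigma : strategy R)
  (P1 : probability (measurableTypeR R) R) (m : R).
Hypothesis D0 : (0 < D)%R.
Hypothesis intP1 : P1.-integrable setT (fun x : measurableTypeR R => (x : R)%:E).
Hypothesis meanP1 : \int[P1]_x (x : R)%:E = 0.
Notation trajectory i := (i.-tuple (bool * R)%type).
Notation normal2 := (normal_prob m (Num.sqrt D)).

Lemma integral_step_integrable i (h : trajectory i)
    (f : trajectory i.+1 -> \bar R) :
  measurable_fun setT f ->
  normal2.-integrable setT (fun x => f (extend h true x)) ->
  P1.-integrable setT (fun x => f (extend h false x)) ->
  \int[step M D P1 sigma m h]_h' f h' =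
    (prob2 M sigma h)%:E * \int[normal2]_x f (extend h true x) +
    (1 - prob2 M sigma h)%:E * \int[P1]_x f (extend h false x).
Proof.
move=> mf int2 int1; rewrite integralE.
rewrite (integral_step M D sigma P1 m h (measurable_funepos mf)) => [|h'];
  last exact: funepos_ge0.
rewrite (integral_step M D sigma P1 m h (measurable_funeneg mf)) => [|h'];
  last exact: funeneg_ge0.
rewrite [in RHS]integralE [X in _ = _ + _ * X]integralE.
have := integrable_pos_fin_num measurableT int2.
have := integrable_neg_fin_num measurableT int2.
have := integrable_pos_fin_num measurableT int1.
have := integrable_neg_fin_num measurableT int1.
have posE y : (fun x => f (extend h y x))^\+ = (fun x => f^\+ (extend h y x)).
  by apply/funext => x; rewrite !funeposE.
have negE y : (fun x => f (extend h y x))^\- = (fun x => f^\- (extend h y x)).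
  by apply/funext => x; rewrite !funenegE.
rewrite !posE !negE.
(* All four parts are finite, so the regrouping of positive and negative parts takes place among
   real numbers. *)
move=> /fineK <- /fineK <- /fineK <- /fineK <-.
by rewrite -!(EFinB, EFinM, EFinD); congr EFin; ring.
Qed.

(** The income minus its compensator: each use of the unknown arm has mean [m] and each use of the
    known one mean 0. It is a martingale under every strategy. *)
Definition centered_income (h : seq (bool * R)) : R :=
  (total_income h - m * (count2 h)%:R)%R.

Lemma centered_income_rcons h e :
  centered_income (rcons h e) =
  (centered_income h + (if e.1 then e.2 - m else e.2))%R.
Proof.
rewrite /centered_income /total_income /count2 -cats1 big_cat count_cat/=.
rewrite big_seq1 addn0; case: e.1 => /=; last by rewrite addn0; ring.
by rewrite natrD; ring.
Qed.

Lemma measurable_count2 i :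
  measurable_fun setT (fun h : trajectory i => (count2 h)%:R : R).
Proof.
apply/measurable_EFinP.
have := @measurable_state R i (fun a _ => (count id a)%:R%:E).
move=> /(_ (fun=> @measurable_cst _ _ _ _ _ _)).
by apply: eq_measurable_fun => h _; rewrite /count2 count_map.
Qed.

Lemma measurable_centered_income i :
  measurable_fun setT (fun h : trajectory i => centered_income h).
Proof.
apply: measurable_funB; last by apply: measurable_funM => //; exact: measurable_count2.
under eq_fun do rewrite /total_income big_tuple.
by apply: measurable_sum => j; exact: measurable_snd_tnth.
Qed.

Lemma integrable_add_cst (P : probability (measurableTypeR R) R) (c : R)
    (g : measurableTypeR R -> R) :
  P.-integrable setT (fun x => (g x)%:E) ->
  P.-integrable setT (fun x => (c + g x)%:E) /\
  \int[P]_x (c + g x)%:E = c%:E + \int[P]_x (g x)%:E.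
Proof.
move=> intg; have intc : P.-integrable setT (cst c%:E).
  by apply: finite_measure_integrable_cst.
under eq_fun do rewrite EFinD.
split; first exact: integrableD.
rewrite integralD//; congr (_ + _).
by rewrite integral_cst// -[RHS]mule1; congr (_ * _); exact: probability_setT.
Qed.

Lemma integrable_centered_normal : normal2.-integrable setT
  (fun x : measurableTypeR R => ((x : R) - m)%:E).
Proof.
apply/integrableP; split.
  by apply/measurable_EFinP; exact: measurable_funB.
exact: integral_centered_normal_fin.
Qed.

(** The increment has mean 0 under either action, so the selection probability cancels. *)
Lemma integral_step_centered_income i (h : trajectory i) :
  \int[step M D P1 sigma m h]_h' (centered_income h')%:E =
  (centered_income h)%:E.
Proof.
have mS : measurable_fun setT
    (fun h : trajectory i.+1 => (centered_income h)%:E).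
  by apply/measurable_EFinP; exact: measurable_centered_income.
have [int2 E2] := integrable_add_cst (centered_income h) integrable_centered_normal.
have [int1 E1] := integrable_add_cst (centered_income h) intP1.
rewrite integral_step_integrable//.
- under eq_integral do rewrite /= centered_income_rcons/=.
  under [X in _ + _ * X]eq_integral do rewrite /= centered_income_rcons/=.
  rewrite E2 E1 meanP1 integral_centered_normal// !adde0 -!EFinM -EFinD.
  by congr EFin; ring.
- by under eq_fun do rewrite /= centered_income_rcons/=.
- by under eq_fun do rewrite /= centered_income_rcons/=.
Qed.

(** Whichever arm is used, the expected absolute increment is at most [A1 + A2], so the absolute
    moment grows at most linearly in the number of steps. *)
Lemma integrable_centered_income i :
  (trajectory_law M D P1 sigma m i).-integrable setT
    (fun h => (centered_income h)%:E).
Proof.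
have mS j : measurable_fun setT
    (fun h : trajectory j => (centered_income h)%:E).
  by apply/measurable_EFinP; exact: measurable_centered_income.
have mA j : measurable_fun setT (fun h : trajectory j => `|centered_income h|%:E).
  by apply/measurable_EFinP; apply: measurableT_comp => //;
    exact: measurable_centered_income.
apply/integrableP; split; first exact: mS.
elim: i => [|i IH].
  rewrite /= integral_dirac//; last exact: mA.
  by rewrite diracT mul1e ltry.
rewrite ge0_integral_kernel_bind//; last exact: mA.
pose A2 := \int[normal2]_x `|(x : R) - m|%:E.
pose A1 := \int[P1]_x `|x : R|%:E.
have A2fin : A2 < +oo by exact: integral_centered_normal_fin.
have A1fin : A1 < +oo by have /integrableP[] := intP1.
have A20 : 0 <= A2 by apply: integral_ge0.
have A10 : 0 <= A1 by apply: integral_ge0.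
apply: (@le_lt_trans _ _ (\int[trajectory_law M D P1 sigma m i]_h
    (`|centered_income h|%:E + (A1 + A2)))).
  apply: ge0_le_integral => //.
  - by move=> h _; exact: integral_ge0.
  - apply: measurable_fun_integral_kernel => //; last exact: mA.
    by move=> U mU; exact: (measurable_kernel (step M D P1 sigma m (i:=i))).
  - by apply: emeasurable_funD; [exact: (mA i)|exact: measurable_cst].
  move=> h _; rewrite (integral_step M D sigma P1 m h (mA i.+1))//.
  have /andP[p0 p1] := prob2_01 M sigma h.
  have absD (P : probability (measurableTypeR R) R) (g : measurableTypeR R -> R) :
      measurable_fun setT g ->
      \int[P]_x `|centered_income h + g x|%:E <=
      `|centered_income h|%:E + \int[P]_x `|g x|%:E.
    move=> mg; have mag : measurable_fun setT (fun x : measurableTypeR R => `|g x|%:E).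
      by apply/measurable_EFinP; apply: measurableT_comp.
    apply: (@le_trans _ _ (\int[P]_x (`|centered_income h|%:E + `|g x|%:E))).
      apply: ge0_le_integral => //.
      - apply/measurable_EFinP; apply: measurableT_comp => //.
        exact: measurable_funD.
      - exact: emeasurable_funD.
      - by move=> x _; rewrite -EFinD lee_fin ler_normD.
    rewrite ge0_integralD// integral_cst//.
    by rewrite [X in _ * X + _](_ : _ = 1) ?mule1//; exact: probability_setT.
  have le2 : \int[normal2]_x `|centered_income (extend h true x)|%:E <=
      `|centered_income h|%:E + (A1 + A2).
    under eq_integral do rewrite /= centered_income_rcons/=.
    apply: (le_trans (absD _ (fun x => (x : R) - m)%R _)).
      exact: measurable_funB.
    by rewrite leeD2l// leeDr.
  have le1 : \int[P1]_x `|centered_income (extend h false x)|%:E <=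
      `|centered_income h|%:E + (A1 + A2).
    under eq_integral do rewrite /= centered_income_rcons/=.
    apply: (le_trans (absD _ (fun x => (x : R))%R _)) => //.
    by rewrite leeD2l// leeDl.
  have p1' : (0 <= 1 - prob2 M sigma h)%R by rewrite subr_ge0.
  apply: (le_trans (leeD (lee_wpmul2l _ le2) (lee_wpmul2l _ le1))); rewrite ?lee_fin//.
  rewrite -ge0_muleDl ?lee_fin// -EFinD addrC subrK mul1e//.
rewrite ge0_integralD//; first last.
- by move=> h _; rewrite adde_ge0.
- exact: mA.
rewrite integral_cst//= [X in _ + _ * X](_ : _ = 1) ?mule1//; last first.
  exact: probability_setT.
by rewrite lte_add_pinfty// lte_add_pinfty.
Qed.

Lemma integral_centered_income i :
  \int[trajectory_law M D P1 sigma m i]_h (centered_income h)%:E = 0.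
Proof.
elim: i => [|i IH].
  rewrite /= integral_dirac//.
    rewrite diracT mul1e /centered_income /total_income big_nil /count2/=.
    by rewrite mulr0 subr0.
  by apply/measurable_EFinP; exact: measurable_centered_income.
rewrite -[RHS]IH integral_kernel_bind; last exact: integrable_centered_income.
by apply: eq_integral => h _; exact: integral_step_centered_income.
Qed.

Lemma count12E N (h : trajectory N) :
  (N%:R = (count1 h)%:R + (count2 h)%:R :> R)%R.
Proof.
rewrite -natrD /count1 /count2 -[in LHS](size_tuple h).
by rewrite -(count_predC (fun e => e.1)) addnC.
Qed.

Lemma trajectory_cost_bounds N (h : trajectory N) :
  (0 <= Num.max 0 m * (count1 h)%:R + Num.max 0 (- m) * (count2 h)%:R
     <= N%:R * `|m|)%R.
Proof.
have leN (x : R) : (0 <= Num.max 0 x <= `|x|)%R.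
  by rewrite le_max lexx ge_max normr_ge0 ler_norm.
have /andP[mp0 mp1] := leN m; have /andP[mn0 mn1] := leN (- m)%R.
rewrite normrN in mn1.
rewrite addr_ge0 ?mulr_ge0//= (count12E h) mulrDl.
by apply: lerD; rewrite mulrC ler_wpM2l.
Qed.

(** Since the centered income has mean 0, the expected income is m times the expected number n of
    uses of the unknown arm; with N = k + n, N max(0, m) - m n = max(0, m) k + max(0, -m) n. The
    resulting cost is nonnegative and depends on the actions only. *)
Lemma loss_integral N :
  (loss M D P1 sigma m N)%:E =
  \int[trajectory_law M D P1 sigma m N]_h
    (Num.max 0 m * (count1 h)%:R + Num.max 0 (- m) * (count2 h)%:R)%R%:E.
Proof.
pose P := trajectory_law M D P1 sigma m N.
have intS : P.-integrable setT (fun h => (centered_income h)%:E).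
  exact: integrable_centered_income.
have mphi : measurable_fun setT
    (fun h : trajectory N => (N%:R * Num.max 0 m - m * (count2 h)%:R)%R).
  by apply: measurable_funB => //; apply: measurable_funM => //;
    exact: measurable_count2.
have NE := @count12E N.
have phiE (h : trajectory N) :
    (Num.max 0 m * (count1 h)%:R + Num.max 0 (- m) * (count2 h)%:R =
     N%:R * Num.max 0 m - m * (count2 h)%:R)%R.
  rewrite (NE h); case: (leP 0%R m) => m0.
    by rewrite (max_idPl _) ?oppr_le0//; ring.
  by rewrite (max_idPr _) ?oppr_ge0 ?ltW//; ring.
have intc : P.-integrable setT (fun=> (N%:R * Num.max 0 m)%:E).
  exact: finite_measure_integrable_cst.
have intphi : P.-integrable setT
    (fun h => (N%:R * Num.max 0 m - m * (count2 h)%:R)%:E).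
  apply: (le_integrable measurableT (g := fun=> (N%:R * `|m|)%:E)).
  - exact/measurable_EFinP.
  - move=> h _; rewrite /= lee_fin -phiE.
    have /andP[c0 c1] := trajectory_cost_bounds h.
    by rewrite ger0_norm// [leRHS]ger0_norm// (le_trans c0 c1).
  - exact: finite_measure_integrable_cst.
under [in RHS]eq_integral do rewrite phiE.
(* A splitting into three integrable terms: a constant, a martingale of mean 0, and minus the cost,
   which is bounded. *)
have TE (h : trajectory N) : (total_income h)%:E =
    (N%:R * Num.max 0 m)%:E + (centered_income h)%:E -
    (N%:R * Num.max 0 m - m * (count2 h)%:R)%:E.
  by rewrite -!(EFinB, EFinD); congr EFin; rewrite /centered_income; ring.
rewrite /loss EFinB unlock.
rewrite (eq_integral (fun h : trajectory N =>
    (N%:R * Num.max 0 m)%:E + (centered_income h)%:E -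
    (N%:R * Num.max 0 m - m * (count2 h)%:R)%:E)); last by move=> h _; exact: TE.
rewrite integralB//; last exact: integrableD.
rewrite integralD// integral_centered_income adde0 integral_cst//.
rewrite [X in _ * X](_ : _ = 1) ?mule1; last exact: probability_setT.
have := integrable_fin_num measurableT intphi.
rewrite -/P; move=> /fineK <-.
by rewrite -!(EFinB, EFinD) /= opprB addrCA subrr addr0.
Qed.

Lemma loss_bounds N : (0 <= loss M D P1 sigma m N <= N%:R * `|m|)%R.
Proof.
have bnd (h : trajectory N) := trajectory_cost_bounds h.
have mphi : measurable_fun setT (fun h : trajectory N =>
    (Num.max 0 m * (count1 h)%:R + Num.max 0 (- m) * (count2 h)%:R)%R%:E).
  have := @measurable_state R N (fun a _ =>
    (Num.max 0 m * (count negb a)%:R + Num.max 0 (- m) * (count id a)%:R)%R%:E).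
  move=> /(_ (fun=> @measurable_cst _ _ _ _ _ _)).
  by apply: eq_measurable_fun => h _; rewrite /count1 /count2 !count_map.
rewrite -!lee_fin loss_integral; apply/andP; split.
  by apply: integral_ge0 => h _; rewrite lee_fin; have /andP[] := bnd h.
apply: (@le_trans _ _ (\int[trajectory_law M D P1 sigma m N]_h
    (cst (N%:R * `|m|)%:E h))).
  apply: ge0_le_integral => //.
  - by move=> h _; rewrite lee_fin; have /andP[] := bnd h.
  - by move=> h _; rewrite lee_fin; have /andP[] := bnd h.
rewrite integral_cst//= [X in _ * X](_ : _ = 1) ?mule1//.
exact: probability_setT.
Qed.

End loss.

(** * Change of measure and integration over the prior *)

Section change_of_measure.
Local Open Scope ereal_scope.
Context (R : realType) (M : nat) (D : R) (sigma : strategy R).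
Hypothesis D0 : (0 < D)%R.
Implicit Types (a : seq bool) (X m : R) (n : nat).
Notation bk := (backup M D sigma).

Definition likelihood n X m : R :=
  expR (D^-1 * (X * m - 2^-1 * n%:R * m ^+ 2)).

Lemma likelihood0 m : likelihood 0 0 m = 1%R.
Proof. by rewrite /likelihood mul0r mulr0 mul0r subrr mulr0 expR0. Qed.

Lemma likelihood_ge0 n X m : (0 <= likelihood n X m)%R.
Proof. exact: expR_ge0. Qed.

(** Independent observations multiply likelihood ratios. Both the stepwise change of measure and the
    martingale property of the posterior integrals come from this. *)
Lemma likelihoodD n X k y m : likelihood (n + k) (X + y) m =
  (likelihood n X m * likelihood k y m)%R.
Proof. by rewrite /likelihood -expRD natrD; congr expR; ring. Qed.

Lemma measurable_likelihood n :
  measurable_fun setT (fun p : R * R => likelihood n p.2 p.1).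
Proof.
apply: (measurableT_comp (@measurable_expR R)).
apply: measurable_funM => //; apply: measurable_funB.
  exact: measurable_funM.
by apply: measurable_funM => //; exact: measurable_funX.
Qed.

Lemma gauss_density_likelihood k m y : (0 < k)%N ->
  (gauss_density (k%:R * D) 0 y * likelihood k y m =
   gauss_density (k%:R * D) (k%:R * m) y)%R.
Proof.
move=> k0; have k0' : (0 < k%:R :> R)%R by rewrite ltr0n.
rewrite [RHS]gauss_density_tilt ?mulr_gt0//; congr (_ * expR _)%R.
by field; rewrite !gt_eqF.
Qed.

Lemma ge0_integral_normal_likelihood m (f : R -> \bar R) :
  measurable_fun setT f -> (forall x, 0 <= f x) ->
  \int[normal_prob m (Num.sqrt D)]_x f x =
  \int[gauss D]_x ((likelihood 1 x m)%:E * f x).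
Proof.
move=> mf f0.
have ml : measurable_fun setT (fun x : R => (likelihood 1 x m)%:E).
  apply/measurable_EFinP.
  exact: (measurableT_comp (measurable_likelihood 1) (pair1_measurable m)).
rewrite [LHS](ge0_integral_normal_prob _ _ mf f0).
rewrite [RHS]ge0_integral_gauss.
- apply: eq_integral => x _; rewrite [RHS]muleAC [RHS]muleC; congr (_ * _).
  have := @gauss_density_likelihood 1 m x isT; rewrite !mul1r => gE.
  by rewrite -/(gauss_density D m x) -gE EFinM muleC.
- exact: emeasurable_funM.
- by move=> x; rewrite mule_ge0// lee_fin likelihood_ge0.
Qed.

(** A step of the unknown arm multiplies the weight by the likelihood of one income, exactly the
    density that recenters the normal law at 0; a step of the known arm leaves the weight unchanged.
    The constant [w] will be the prior density at [m]. *)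
Lemma backup_likelihood (w : R) m phi a X : (0 <= w)%R -> nneg_measurable phi ->
  (w * likelihood (count id a) X m)%:E * bk m phi a X =
  bk 0 (fun a X => (w * likelihood (count id a) X m)%:E * phi a X) a X.
Proof.
move=> w0 phiP; rewrite /backup.
have L0 b Y : 0 <= (w * likelihood (count id b) Y m)%:E.
  by rewrite lee_fin mulr_ge0// likelihood_ge0.
have [mf f0] := phiP (rcons a true).
have [_ g0] := phiP (rcons a false).
have mfX : measurable_fun [set: R] (fun x => phi (rcons a true) (X + x)%R).
  by apply: (measurableT_comp mf); exact: measurable_funD.
rewrite ge0_muleDr; last 2 first.
- by rewrite mule_ge0 ?lee_fin ?next_prob2_ge0//; exact: integral_ge0.
- by rewrite mule_ge0 ?lee_fin ?onem_next_prob2_ge0.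
congr (_ + _).
  rewrite muleCA; congr (_ * _).
  rewrite (ge0_integral_normal_likelihood m mfX) => [|x]; last exact: f0.
  have ml : measurable_fun [set: R] (fun x : R => (likelihood 1 x m)%:E).
    apply/measurable_EFinP.
    exact: (measurableT_comp (measurable_likelihood 1) (pair1_measurable m)).
  rewrite -ge0_integralZl//; last 2 first.
  - exact: emeasurable_funM.
  - by move=> x _; rewrite mule_ge0// lee_fin likelihood_ge0.
  apply: eq_integral => x _; rewrite -cats1 count_cat/= addn0 likelihoodD.
  by rewrite muleA -EFinM mulrA cats1.
by rewrite muleCA -cats1 count_cat/= !addn0.
Qed.

Lemma iter_backup_likelihood (w : R) m phi i a X : (0 <= w)%R ->
  nneg_measurable phi ->
  (w * likelihood (count id a) X m)%:E * iter i (bk m) phi a X =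
  iter i (bk 0) (fun a X => (w * likelihood (count id a) X m)%:E * phi a X) a X.
Proof.
move=> w0 phiP; elim: i a X => [|i IH] a X; first reflexivity.
have iP : nneg_measurable (iter i (bk m) phi).
  by elim: i {IH} => [//|i IH]; rewrite iterS; exact: nneg_measurable_backup.
have E : (fun b Y => (w * likelihood (count id b) Y m)%:E * iter i (bk m) phi b Y) =
    iter i (bk 0) (fun b Y => (w * likelihood (count id b) Y m)%:E * phi b Y).
  by apply/funext => b; apply/funext => Y; exact: IH.
rewrite [in RHS]iterS -E.
exact: (backup_likelihood m a X w0 iP).
Qed.

End change_of_measure.

(** * Moving the integral over the prior inside the operator *)

Section tonelli.
Local Open Scope ereal_scope.
Context (R : realType) (M : nat) (D : R) (sigma : strategy R).
Context d (T : measurableType d) (mu : {sigma_finite_measure set T -> \bar R}).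
Notation bk := (backup M D sigma).

Definition jointly_nneg_measurable (phi : T -> seq bool -> R -> \bar R) :=
  forall a, measurable_fun setT (fun p : T * measurableTypeR R => phi p.1 a p.2) /\
    forall m X, 0 <= phi m a X.

Lemma jointly_nneg_measurableT phi m :
  jointly_nneg_measurable phi -> nneg_measurable (phi m).
Proof.
move=> phiP a; have [mphi phi0] := phiP a; split=> [|X]; last exact: phi0.
exact: (measurableT_comp mphi (pair1_measurable m)).
Qed.

Lemma jointly_nneg_measurable_backup (z : R) phi : jointly_nneg_measurable phi ->
  jointly_nneg_measurable (fun m => bk z (phi m)).
Proof.
move=> phiP a; split; last first.
  move=> m X.
  by have [] := nneg_measurable_backup M D sigma z
    (jointly_nneg_measurableT m phiP) a.
have mp : measurable_fun setT (fun p : T * measurableTypeR R =>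
    next_prob2 M sigma a p.2).
  by apply: (measurableT_comp (measurable_next_prob2 M sigma a)).
apply: emeasurable_funD; apply: emeasurable_funM.
- exact/measurable_EFinP.
- have [mphi phi0] := phiP (rcons a true).
  apply: (measurable_fun_fubini_tonelli_F (m2 := normal_prob z (Num.sqrt D))
    (fun p : (T * measurableTypeR R) * measurableTypeR R =>
      phi p.1.1 (rcons a true) (p.1.2 + p.2)%R)) => //.
  have mshift : measurable_fun setT
      (fun p : (T * measurableTypeR R) * measurableTypeR R =>
        (p.1.1, (p.1.2 + p.2)%R : measurableTypeR R)).
    apply: measurable_fun_pair; first exact: measurableT_comp.
    by apply: measurable_funD => //; exact: measurableT_comp.
  exact: (measurableT_comp mphi mshift).
- by apply/measurable_EFinP; exact: measurable_funB.
- by have [] := phiP (rcons a false).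
Qed.

(** The change of measure pays off here: the operator has a fixed mean [z], the same for all
    parameters, so Tonelli lets the prior integral pass through it. *)
Lemma integral_backup (z : R) phi a X : jointly_nneg_measurable phi ->
  \int[mu]_m bk z (phi m) a X = bk z (fun a X => \int[mu]_m phi m a X) a X.
Proof.
move=> phiP; rewrite /backup.
have [mf f0] := phiP (rcons a true); have [mg g0] := phiP (rcons a false).
have mfX : measurable_fun setT (fun p : T * measurableTypeR R =>
    phi p.1 (rcons a true) (X + p.2)%R).
  have mshift : measurable_fun setT
      (fun p : T * measurableTypeR R => (p.1, (X + p.2)%R : measurableTypeR R)).
    by apply: measurable_fun_pair => //; exact: measurable_funD.
  exact: (measurableT_comp mf mshift).
have mF : measurable_fun setT (fun m =>
    \int[normal_prob z (Num.sqrt D)]_x phi m (rcons a true) (X + x)%R).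
  exact: (measurable_fun_fubini_tonelli_F (m2 := normal_prob z (Num.sqrt D))
    (fun p : T * measurableTypeR R => phi p.1 (rcons a true) (X + p.2)%R)).
have F0 m : 0 <= \int[normal_prob z (Num.sqrt D)]_x phi m (rcons a true) (X + x)%R.
  exact: integral_ge0.
have mG : measurable_fun setT (fun m => phi m (rcons a false) X).
  exact: (measurableT_comp mg (pair2_measurable X)).
rewrite ge0_integralD//; last 4 first.
- by move=> m _; rewrite mule_ge0// lee_fin next_prob2_ge0.
- exact: emeasurable_funM.
- by move=> m _; rewrite mule_ge0// lee_fin onem_next_prob2_ge0.
- exact: emeasurable_funM.
rewrite !ge0_integralZl ?lee_fin ?next_prob2_ge0 ?onem_next_prob2_ge0//.
congr (_ * _ + _).
exact: (fubini_tonelli (m1 := mu) (m2 := normal_prob z (Num.sqrt D))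
  (fun p : T * measurableTypeR R => phi p.1 (rcons a true) (X + p.2)%R)).
Qed.

Lemma integral_iter_backup (z : R) phi i a X : jointly_nneg_measurable phi ->
  \int[mu]_m iter i (bk z) (phi m) a X =
  iter i (bk z) (fun a X => \int[mu]_m phi m a X) a X.
Proof.
move=> phiP; elim: i a X => [|i IH] a X; first reflexivity.
have mi : jointly_nneg_measurable (fun m => iter i (bk z) (phi m)).
  by elim: i {IH} => [//|i IH]; exact: jointly_nneg_measurable_backup.
rewrite iterS -(_ : (fun a X => \int[mu]_m iter i (bk z) (phi m) a X) =
  iter i (bk z) (fun a X => \int[mu]_m phi m a X)); last first.
  by apply/funext => b; apply/funext => Y; exact: IH.
by rewrite -integral_backup.
Qed.

End tonelli.

(** * Batches *)

Section batch.
Local Open Scope ereal_scope.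
Context (R : realType) (M : nat) (D : R) (sigma : strategy R).
Hypotheses (D0 : (0 < D)%R) (M0 : (0 < M)%N).
Implicit Types (a : seq bool) (X : R).
Notation bk := (backup M D sigma 0).

(** Strictly inside a batch one of the two counts exceeds a multiple of [M] by 0 < k < M, so no
    selection takes place and the last action is repeated. *)
Lemma next_prob2_repeat a k y X :
  (M %| count negb a)%N -> (M %| count id a)%N -> (0 < k < M)%N ->
  next_prob2 M sigma (a ++ nseq k y) X = y%:R.
Proof.
move=> d1 d2 /andP[k0 kM]; rewrite /next_prob2 last_cat.
have -> : last (last false a) (nseq k y) = y.
  by case: k k0 {kM} => // k _ /=; elim: k.
rewrite !count_cat !count_nseq !dvdn_addr//.
have ndvd : (M %| k)%N = false by rewrite gtnNdvd.
by case: y; rewrite /= !mul1n !ndvd ?andbF.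
Qed.

Lemma nneg_measurable_iter_backup phi i : nneg_measurable phi ->
  nneg_measurable (iter i bk phi).
Proof.
by move=> phiP; elim: i => [//|i IH]; rewrite iterS; exact: nneg_measurable_backup.
Qed.

Lemma rcons_cat_nseq a k y : rcons (a ++ nseq k y) y = a ++ nseq k.+1 y.
Proof. by rewrite rcons_cat -cats1 -(nseqD k 1) addn1. Qed.

Lemma backup_repeat1 phi a k X :
  (M %| count negb a)%N -> (M %| count id a)%N -> (0 < k < M)%N ->
  bk phi (a ++ nseq k false) X = phi (a ++ nseq k.+1 false) X.
Proof.
move=> d1 d2 kM; rewrite /backup next_prob2_repeat//.
by rewrite mul0e add0e subr0 mul1e rcons_cat_nseq.
Qed.

Lemma backup_repeat2 phi a k X :
  (M %| count negb a)%N -> (M %| count id a)%N -> (0 < k < M)%N ->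
  bk phi (a ++ nseq k true) X =
  \int[gauss D]_x phi (a ++ nseq k.+1 true) (X + x)%R.
Proof.
move=> d1 d2 kM; rewrite /backup next_prob2_repeat//.
by rewrite subrr mul0e adde0 mul1e rcons_cat_nseq.
Qed.

(** Here [j] counts the steps left in the batch; [j < M] says that its action has already been
    selected. *)
Lemma iter_backup_arm1 phi a j X :
  (M %| count negb a)%N -> (M %| count id a)%N -> (j < M)%N ->
  iter j bk phi (a ++ nseq (M - j) false) X = phi (a ++ nseq M false) X.
Proof.
move=> d1 d2; elim: j X => [|j IH] X jM; first by rewrite subn0.
have kM : (0 < M - j.+1 < M)%N by rewrite subn_gt0 jM ltn_subrL.
have := backup_repeat1 (iter j bk phi) X d1 d2 kM.
rewrite subnSK; last exact: ltnW jM.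
by move=> E; apply: (etrans E); exact: IH (ltnW jM).
Qed.

(** The outer integral is the step just made. Keeping it in the statement makes the variances run
    through D, 2 D, ..., M D; without it the base case would have variance 0, where [gauss] is not a
    point mass. *)
Lemma iter_backup_arm2 phi a j X : nneg_measurable phi ->
  (M %| count negb a)%N -> (M %| count id a)%N -> (j < M)%N ->
  \int[gauss D]_x iter j bk phi (a ++ nseq (M - j) true) (X + x)%R =
  \int[gauss (j.+1%:R * D)]_y phi (a ++ nseq M true) (X + y)%R.
Proof.
move=> phiP d1 d2; elim: j X => [|j IH] X jM; first by rewrite subn0 mul1r.
have [mphi phi0] := phiP (a ++ nseq M true).
have kM : (0 < M - j.+1 < M)%N by rewrite subn_gt0 jM ltn_subrL.
have E x : iter j.+1 bk phi (a ++ nseq (M - j.+1) true) (X + x)%R =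
    \int[gauss (j.+1%:R * D)]_y phi (a ++ nseq M true) (X + (x + y))%R.
  have := backup_repeat2 (iter j bk phi) (X + x) d1 d2 kM.
  rewrite subnSK; last exact: ltnW jM.
  move=> E; apply: (etrans E).
  rewrite [LHS](IH _ (ltnW jM)).
  by apply: eq_integral => y _; rewrite addrA.
have mX : measurable_fun [set: R] (fun z => phi (a ++ nseq M true) (X + z)%R).
  by apply: (measurableT_comp mphi); exact: measurable_funD.
have jD0 : (0 < j.+1%:R * D)%R by rewrite mulr_gt0.
have -> : (j.+2%:R * D = D + j.+1%:R * D)%R by rewrite -[in LHS]natr1 mulrDl mul1r addrC.
apply: etrans (ge0_integral_gaussD D0 jD0 mX (fun=> phi0 _)).
by apply: eq_integral => x _; rewrite E.
Qed.

(** Only the first step of a batch is a selection; the other [M.-1] steps are forced. *)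
Lemma iter_backup_batch phi a X : nneg_measurable phi ->
  (M %| count negb a)%N -> (M %| count id a)%N ->
  iter M bk phi a X =
  (next_prob2 M sigma a X)%:E *
    \int[gauss (M%:R * D)]_y phi (a ++ nseq M true) (X + y)%R +
  (1 - next_prob2 M sigma a X)%:E * phi (a ++ nseq M false) X.
Proof.
move=> phiP d1 d2.
have M1 : (M.-1 < M)%N by rewrite prednK.
have M1E : (M - M.-1 = 1)%N by rewrite -{1}(prednK M0) subSn// subnn.
have E2 := iter_backup_arm2 X phiP d1 d2 M1.
have E1 := iter_backup_arm1 phi X d1 d2 M1.
rewrite M1E (prednK M0) in E2; rewrite M1E in E1.
have -> B : iter M B phi = B (iter M.-1 B phi) by rewrite -{1}(prednK M0).
by rewrite -E2 -E1 !cats1.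
Qed.

End batch.

(** * Optimal stopping *)

Section batch_mean.
Local Open Scope ereal_scope.
Context (R : realType) (M : nat) (D : R).
Hypotheses (D0 : (0 < D)%R) (M0 : (0 < M)%N).
Implicit Types (V W : nat -> R -> \bar R) (n : nat) (X : R).

Definition nneg_family V :=
  forall n, measurable_fun [set: R] (V n) /\ forall X, 0 <= V n X.

(** The conditional expectation of V after one batch of the unknown arm, under the reference mean
    0. *)
Definition batch_mean V n X : \bar R :=
  \int[gauss (M%:R * D)]_y V (n + M)%N (X + y)%R.

Lemma measurable_shift (f : R -> \bar R) X : measurable_fun [set: R] f ->
  measurable_fun [set: R] (fun y => f (X + y)%R).
Proof. by move=> mf; apply: (measurableT_comp mf); exact: measurable_funD. Qed.

Lemma nneg_family_batch_mean V : nneg_family V -> nneg_family (batch_mean V).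
Proof.
move=> VP n; have [mV V0] := VP (n + M)%N; split.
  exact: measurable_integral_shift.
by move=> X; apply: integral_ge0 => y _; exact: V0.
Qed.

Lemma le_batch_mean V W n X : nneg_family V -> nneg_family W ->
  (forall k Y, V k Y <= W k Y) -> batch_mean V n X <= batch_mean W n X.
Proof.
move=> VP WP VW; have [mV V0] := VP (n + M)%N; have [mW W0] := WP (n + M)%N.
apply: ge0_le_integral.
- exact: measurableT.
- by move=> y _; exact: V0.
- exact: measurable_shift.
- exact: measurable_shift.
- by move=> y _; exact: VW.
Qed.

Lemma batch_meanD V W n X : nneg_family V -> nneg_family W ->
  batch_mean (fun k Y => V k Y + W k Y) n X =
  batch_mean V n X + batch_mean W n X.
Proof.
move=> VP WP; have [mV V0] := VP (n + M)%N; have [mW W0] := WP (n + M)%N.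
apply: ge0_integralD.
- exact: measurableT.
- by move=> y _; exact: V0.
- exact: measurable_shift.
- by move=> y _; exact: W0.
- exact: measurable_shift.
Qed.

Lemma batch_meanZ (k : R) V n X : (0 <= k)%R -> nneg_family V ->
  batch_mean (fun n Y => k%:E * V n Y) n X = k%:E * batch_mean V n X.
Proof.
move=> k0 VP; have [mV V0] := VP (n + M)%N.
apply: ge0_integralZl.
- exact: measurableT.
- exact: measurable_shift.
- by move=> y _; exact: V0.
- by rewrite lee_fin.
Qed.

End batch_mean.

Section stopping.
Local Open Scope ereal_scope.
Context (R : realType) (M : nat) (D : R).
Hypotheses (D0 : (0 < D)%R) (M0 : (0 < M)%N).
Context (G1 G2 : nat -> R -> \bar R).
Hypotheses (G1P : nneg_family G1) (G2P : nneg_family G2).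
Hypothesis G1mart : forall n X, batch_mean M D G1 n X = G1 n X.
Hypothesis G2mart : forall n X, batch_mean M D G2 n X = G2 n X.
Implicit Types (a : seq bool) (n s : nat) (X : R).
Notation mean := (batch_mean M D).

(** With [s] batches left, the first term of the minimum is the cost of playing the known arm to the
    end. One batch counts as one unit, so a factor [M] is restored wherever this value is used. *)
Fixpoint stop_value s n X : \bar R :=
  if s is s'.+1 then
    mine (s%:R%:E * G1 n X) (G2 n X + mean (stop_value s') n X)
  else 0.

Lemma nneg_family_stop_value s : nneg_family (stop_value s).
Proof.
elim: s => [|s IH] n /=.
  by split=> [|X]; [exact: measurable_cst|exact: lexx].
have [mG1 G10] := G1P n; have [mG2 G20] := G2P n.
have [mV V0] := nneg_family_batch_mean M D IH n.
split=> [|X].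
  apply: measurable_mine; first exact: measurable_funeM.
  exact: emeasurable_funD.
by rewrite le_min mule_ge0 ?lee_fin ?ler0n ?G10//= adde_ge0.
Qed.

Lemma stop_value_le s n X : stop_value s n X <= s%:R%:E * G1 n X.
Proof.
case: s => [|s]; first by rewrite mul0e.
by rewrite /= ge_min lexx.
Qed.

Lemma natr1E s x : 0 <= x -> s.+1%:R%:E * x = x + s%:R%:E * x :> \bar R.
Proof.
move=> x0; rewrite -[in LHS]natr1 EFinD ge0_muleDl ?lee_fin//.
by rewrite mul1e addeC.
Qed.

Lemma nneg_familyD V W : nneg_family V -> nneg_family W ->
  @nneg_family R (fun k Y => V k Y + W k Y).
Proof.
move=> VP WP n; have [mV V0] := VP n; have [mW W0] := WP n.
by split=> [|X]; [exact: emeasurable_funD|rewrite adde_ge0].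
Qed.

(* Playing the known arm first cannot help: since the posterior loss [G1] is a
   martingale, a batch of the known arm can be postponed until the stopping
   time without changing its cost. *)
Lemma stop_value_arm1 s n X :
  stop_value s.+1 n X <= G1 n X + stop_value s n X.
Proof.
elim: s n X => [|s IH] n X.
  by rewrite adde0; apply: (le_trans (stop_value_le 1 n X)); rewrite mul1e.
have [mG1 G10] := G1P n; have [mG2 G20] := G2P n.
(* The left side copies the choice that attains the minimum on the right. If that is stopping, both
   sides are compared with [s.+2] known batches; if it is continuing, the induction hypothesis
   applies under the mean and [G1mart] pulls the extra [G1] inside. *)
have [E|E] := leP (s.+1%:R%:E * G1 n X) (G2 n X + mean (stop_value s) n X).
  rewrite [stop_value s.+1 n X](min_idPl E) -natr1E; last exact: G10.
  exact: stop_value_le.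
rewrite [stop_value s.+1 n X](min_idPr (ltW E)).
apply: (@le_trans _ _ (G2 n X + mean (stop_value s.+1) n X)).
  by rewrite [stop_value s.+2 n X]/= ge_min lexx orbT.
rewrite [leRHS]addeCA; apply: leeD2l.
rewrite -[X in X + _]G1mart -batch_meanD//; last exact: nneg_family_stop_value.
apply: le_batch_mean; first exact: nneg_family_stop_value.
  by apply: nneg_familyD => //; exact: nneg_family_stop_value.
by move=> k Y; exact: IH.
Qed.

(** All costs are evaluated at the terminal state, whenever they were incurred. By the martingale
    property it also serves as the cost accumulated up to an intermediate state. *)
Definition final_cost a X : \bar R :=
  (count negb a)%:R%:E * G1 (count id a) X +
  (count id a)%:R%:E * G2 (count id a) X.

Lemma nneg_measurable_final_cost : nneg_measurable final_cost.
Proof.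
move=> a; have [mG1 G10] := G1P (count id a); have [mG2 G20] := G2P (count id a).
split=> [|X].
  by apply: emeasurable_funD; exact: measurable_funeM.
by rewrite adde_ge0// mule_ge0// lee_fin.
Qed.

Lemma count_arm1 a k : count negb (a ++ nseq k false) = (count negb a + k)%N.
Proof. by rewrite count_cat count_nseq mul1n. Qed.

Lemma count_arm1' a k : count id (a ++ nseq k false) = count id a.
Proof. by rewrite count_cat count_nseq mul0n addn0. Qed.

Lemma count_arm2 a k : count id (a ++ nseq k true) = (count id a + k)%N.
Proof. by rewrite count_cat count_nseq mul1n. Qed.

Lemma count_arm2' a k : count negb (a ++ nseq k true) = count negb a.
Proof. by rewrite count_cat count_nseq mul0n addn0. Qed.

Lemma final_cost_arm1 a X :
  final_cost (a ++ nseq M false) X = M%:R%:E * G1 (count id a) X + final_cost a X.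
Proof.
have [_ G10] := G1P (count id a).
rewrite /final_cost count_arm1 count_arm1' natrD EFinD ge0_muleDl ?lee_fin//.
by rewrite addeA [X in X + _]addeC.
Qed.

(** Both martingale identities bring the terminal cost back to the present state, where the batch
    adds [M] times [G2]. The summand [V] carries the value of the remaining batches. *)
Lemma mean_final_cost_arm2 a X (V : nat -> R -> \bar R) : nneg_family V ->
  \int[gauss (M%:R * D)]_y (final_cost (a ++ nseq M true) (X + y)%R +
    V (count id a + M)%N (X + y)%R) =
  final_cost a X + M%:R%:E * G2 (count id a) X + mean V (count id a) X.
Proof.
move=> VP; set n := count id a.
have c1P : nneg_family (fun k Y => (count negb a)%:R%:E * G1 k Y).
  move=> k; have [mG1 G10] := G1P k; split; first exact: measurable_funeM.
  by move=> Y; rewrite mule_ge0// lee_fin.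
have c2P : nneg_family (fun k Y => (n + M)%:R%:E * G2 k Y).
  move=> k; have [mG2 G20] := G2P k; split; first exact: measurable_funeM.
  by move=> Y; rewrite mule_ge0// lee_fin.
transitivity (mean (fun k Y => (count negb a)%:R%:E * G1 k Y +
    (n + M)%:R%:E * G2 k Y + V k Y) n X).
  by apply: eq_integral => y _; rewrite /final_cost count_arm2 count_arm2'.
rewrite batch_meanD//; last exact: nneg_familyD.
rewrite batch_meanD// !batch_meanZ// G1mart G2mart; congr (_ + _).
have [_ G20] := G2P n.
by rewrite natrD EFinD ge0_muleDl ?lee_fin// addeA.
Qed.

Lemma nneg_familyZ (k : R) V : (0 <= k)%R -> nneg_family V ->
  @nneg_family R (fun n Y => k%:E * V n Y).
Proof.
move=> k0 VP n; have [mV V0] := VP n; split; first exact: measurable_funeM.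
by move=> X; rewrite mule_ge0// lee_fin.
Qed.

(** Cost so far plus optimal cost to come never exceeds the cost of [sigma], from any batch
    boundary, including histories that already mix both arms. Since a randomized selection averages
    two branches, each branch is bounded separately. *)
Lemma stop_value_lower_bound sigma j a X :
  (M %| count negb a)%N -> (M %| count id a)%N ->
  final_cost a X + M%:R%:E * stop_value j (count id a) X <=
  iter (j * M) (backup M D sigma 0) final_cost a X.
Proof.
elim: j a X => [|j IH] a X d1 d2; first by rewrite mul0n mule0 adde0.
set B := backup M D sigma 0; set n := count id a.
have FP := nneg_measurable_final_cost.
have IP : nneg_measurable (iter (j * M) B final_cost).
  exact: nneg_measurable_iter_backup.
have VP := nneg_family_stop_value j.
have MVP : nneg_family (fun n Y => M%:R%:E * stop_value j n Y).
  exact: nneg_familyZ.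
have [_ VS0] := nneg_family_stop_value j.+1 n.
have F0 : 0 <= final_cost a X by have [] := FP a.
have L0 : 0 <= final_cost a X + M%:R%:E * stop_value j.+1 n X.
  by rewrite adde_ge0// mule_ge0// lee_fin.
rewrite mulSn iterD (iter_backup_batch _ D0 M0 X IP d1 d2).
set p := next_prob2 M sigma a X.
have p0 : 0 <= p%:E by rewrite lee_fin next_prob2_ge0.
have q0 : 0 <= (1 - p)%:E by rewrite lee_fin onem_next_prob2_ge0.
have pq : p%:E + (1 - p)%:E = 1 by rewrite -EFinD; congr EFin; ring.
(* The left side is split with the weights of the selection, to be compared branch by branch. *)
have -> : final_cost a X + M%:R%:E * stop_value j.+1 n X =
    p%:E * (final_cost a X + M%:R%:E * stop_value j.+1 n X) +
    (1 - p)%:E * (final_cost a X + M%:R%:E * stop_value j.+1 n X).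
  by rewrite -ge0_muleDl// pq mul1e.
(* The unknown arm is covered by the second term of the minimum, the known arm by
   [stop_value_arm1]. *)
apply: leeD; apply: lee_wpmul2l => //.
- apply: (@le_trans _ _ (\int[gauss (M%:R * D)]_y
      (final_cost (a ++ nseq M true) (X + y)%R +
       M%:R%:E * stop_value j (n + M)%N (X + y)%R))).
    rewrite (mean_final_cost_arm2 a X MVP) -[leRHS]addeA; apply: leeD2l.
    rewrite batch_meanZ// -ge0_muleDr; last 2 first.
    + by have [] := G2P n.
    + by have [] := nneg_family_batch_mean M D VP n.
    by apply: lee_wpmul2l; [rewrite lee_fin|rewrite /= ge_min lexx orbT].
  have [mF F0'] := FP (a ++ nseq M true).
  have [mI I0] := IP (a ++ nseq M true).
  have [mV V0] := MVP (n + M)%N.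
  apply: ge0_le_integral.
  + exact: measurableT.
  + by move=> y _; apply: adde_ge0; [exact: F0'|exact: V0].
  + apply: emeasurable_funD; first exact: (measurable_shift X mF).
    exact: (measurable_shift X mV).
  + exact: (measurable_shift X mI).
  + move=> y _; have := IH (a ++ nseq M true) (X + y)%R.
    rewrite count_arm2 count_arm2'; apply => //.
    by rewrite dvdn_addr.
- have := IH (a ++ nseq M false) X.
  rewrite count_arm1 count_arm1' final_cost_arm1 => IH'.
  apply: le_trans (IH' _ d2); last by rewrite dvdn_addr.
  rewrite [leRHS]addeAC [leRHS]addeC -[X in _ <= _ + X]ge0_muleDr; last 2 first.
  + by have [] := G1P n.
  + by have [] := VP n.
  apply: leeD2l; apply: lee_wpmul2l; first by rewrite lee_fin.
  exact: stop_value_arm1.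
Qed.

End stopping.

(** * A strategy that attains the bound *)

Section optimal_strategy.
Local Open Scope ereal_scope.
Context (R : realType) (M : nat) (D : R).
Hypotheses (D0 : (0 < D)%R) (M0 : (0 < M)%N).
Context (G1 G2 : nat -> R -> \bar R).
Hypotheses (G1P : nneg_family G1) (G2P : nneg_family G2).
Hypothesis G1mart : forall n X, batch_mean M D G1 n X = G1 n X.
Hypothesis G2mart : forall n X, batch_mean M D G2 n X = G2 n X.
Context (J : nat).
Implicit Types (a : seq bool) (n k : nat) (X : R).
Notation V := (stop_value M D G1 G2).

(* After [n] incomes of the unknown arm and none of the known one, [J - n %/ M]
   batches remain. *)
Definition continues k X n : bool :=
  let s := (J - n %/ M)%N in
  (k == 0%N) && (G2 n X + batch_mean M D (V s.-1) n X < s%:R%:E * G1 n X).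

Lemma measurable_continues k n : measurable_fun [set: R] (fun X => continues k X n).
Proof.
apply: (measurable_fun_bool true); rewrite setTI.
have [->|k0] := eqVneq k 0%N; last first.
  rewrite [X in measurable X](_ : _ = set0)//.
  by apply/seteqP; split => X //=; rewrite /continues (negbTE k0).
rewrite -[X in measurable X]setTI; apply: measurable_lte => //.
- have [mG2 _] := G2P n.
  have VP := nneg_family_stop_value M D G1P G2P (J - n %/ M)%N.-1.
  have [mV _] := nneg_family_batch_mean M D VP n.
  exact: emeasurable_funD.
- by have [mG1 _] := G1P n; exact: measurable_funeM.
Qed.

Lemma continues_01 k X n : (0 <= ((continues k X n)%:R : R) <= 1)%R.
Proof. by case: continues; rewrite ?lexx ?ler01. Qed.

Lemma measurable_continues_natr k n :
  measurable_fun [set: R] (fun X => (continues k X n)%:R : R).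
Proof.
rewrite (_ : (fun X => _) = fun X => if continues k X n then 1%R else 0%R).
  by apply: measurable_fun_ifT => //; exact: measurable_continues.
by apply/funext => X; case: continues.
Qed.

(** Deterministic, and absorbed by the known arm, since continuing demands [k = 0]. Ties go to the
    known arm. *)
Definition optimal_strategy : strategy R :=
  Strategy continues_01 measurable_continues_natr.

Notation B := (backup M D optimal_strategy 0).
Notation F := (final_cost G1 G2).

Lemma next_prob2_optimal a X :
  (M %| count negb a)%N -> (M %| count id a)%N ->
  next_prob2 M optimal_strategy a X =
  (continues (count negb a) X (count id a))%:R.
Proof. by move=> d1 d2; rewrite /next_prob2 d1 d2. Qed.

Lemma iter_backup_stopped j a X :
  (M %| count negb a)%N -> (M %| count id a)%N -> (0 < count negb a)%N ->
  iter (j * M) B F a X = F a X + (j * M)%:R%:E * G1 (count id a) X.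
Proof.
elim: j a X => [|j IH] a X d1 d2 c0; first by rewrite mul0n mul0e adde0.
have FP := nneg_measurable_final_cost G1P G2P.
have IP : nneg_measurable (iter (j * M) B F).
  exact: nneg_measurable_iter_backup.
have [_ G10] := G1P (count id a).
rewrite mulSn iterD (iter_backup_batch _ D0 M0 X IP d1 d2).
rewrite next_prob2_optimal// /continues eqn0Ngt c0 /=.
rewrite mul0e add0e subr0 mul1e IH ?count_arm1 ?count_arm1' ?dvdn_addr//; last first.
  by rewrite addn_gt0 c0.
rewrite (final_cost_arm1 M G2 G1P) natrD EFinD ge0_muleDl ?lee_fin//.
by rewrite [X in X + _]addeC addeA.
Qed.

(** The lower bound with equality: as long as only the unknown arm has been used, the selection
    follows the term of [stop_value] that attains the minimum, and [iter_backup_stopped] evaluates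
    the rest after stopping. *)
Lemma iter_backup_optimal j a X :
  count negb a = 0%N -> (M %| count id a)%N -> (count id a = (J - j) * M)%N ->
  (j <= J)%N ->
  iter (j * M) B F a X = F a X + M%:R%:E * V j (count id a) X.
Proof.
elim: j a X => [|j IH] a X c0 d2 cJ jJ; first by rewrite mul0n mule0 adde0.
have FP := nneg_measurable_final_cost G1P G2P.
have IP : nneg_measurable (iter (j * M) B F).
  exact: nneg_measurable_iter_backup.
have VP := nneg_family_stop_value M D G1P G2P j.
have MVP : nneg_family (fun n Y => M%:R%:E * V j n Y).
  exact: nneg_familyZ.
have d1 : (M %| count negb a)%N by rewrite c0 dvdn0.
have [_ G10] := G1P (count id a); have [_ G20] := G2P (count id a).
have [_ mV0] := nneg_family_batch_mean M D VP (count id a).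
(* All past batches used the unknown arm, so its count alone tells the strategy how many batches
   remain. *)
have sE : (J - count id a %/ M)%N = j.+1 by rewrite cJ mulnK// subKn.
rewrite mulSn iterD (iter_backup_batch _ D0 M0 X IP d1 d2).
rewrite next_prob2_optimal// /continues c0 eqxx /= sE /=.
have [E|E] := ltP (G2 (count id a) X + batch_mean M D (V j) (count id a) X)
    (j.+1%:R%:E * G1 (count id a) X).
  rewrite subrr mul0e adde0 mul1e.
  transitivity (\int[gauss (M%:R * D)]_y
      (F (a ++ nseq M true) (X + y)%R +
       M%:R%:E * V j (count id a + M)%N (X + y)%R)).
    apply: eq_integral => y _; rewrite IH ?count_arm2 ?count_arm2' ?dvdn_addr//.
    - by rewrite cJ -mulSnr subnSK.
    - exact: ltnW.
  rewrite (mean_final_cost_arm2 G1P G2P G1mart G2mart a X MVP) -[LHS]addeA.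
  by rewrite batch_meanZ// -ge0_muleDr.
rewrite mul0e add0e subr0 mul1e.
rewrite iter_backup_stopped ?count_arm1 ?count_arm1' ?dvdn_addr//; last first.
  by rewrite c0 add0n.
rewrite (final_cost_arm1 M G2 G1P) [X in X + _]addeC -[LHS]addeA; congr (_ + _).
rewrite -ge0_muleDl ?lee_fin// -EFinD -natrD muleA -EFinM -natrM.
by rewrite -mulSn mulnC.
Qed.

End optimal_strategy.

(** * Bayesian risk *)

Section bayes_risk.
Local Open Scope ereal_scope.
Context (R : realType) (M : nat) (D C : R) (lambda : R -> R).
Hypotheses (D0 : (0 < D)%R) (M0 : (0 < M)%N) (C0 : (0 < C)%R).
Hypothesis priorP : is_prior C lambda.
Notation mu := (@lebesgue_measure R).
Implicit Types (f : R -> R) (m X : R) (n : nat).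

(** Extension by 0, so that Tonelli and the changes of variable can be applied on the whole line. *)
Definition prior0 : R -> R := lambda \_ [set` `[- C, C]%R].

Lemma prior0E m : m \in `[- C, C]%R -> prior0 m = lambda m.
Proof. by move=> mC; rewrite /prior0 patchE mem_set. Qed.

Lemma prior0_out m : m \notin `[- C, C]%R -> prior0 m = 0%R.
Proof. by move=> mC; rewrite /prior0 patchE memNset//= => /(negP mC). Qed.

Lemma prior0_ge0 m : (0 <= prior0 m)%R.
Proof.
have [_ l0 _ _ _] := priorP.
by have [mC|mC] := boolP (m \in `[- C, C]%R);
  [rewrite prior0E// l0|rewrite prior0_out].
Qed.

Lemma measurable_prior0 : measurable_fun [set: R] prior0.
Proof.
by have [ml _ _ _ _] := priorP; apply/(measurable_restrictT lambda).
Qed.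

Lemma integral_prior0 : \int[mu]_m (prior0 m)%:E = 1.
Proof.
have [_ _ l1 _ _] := priorP.
have E : \int[mu]_(m in [set` `[- C, C]%R]) (lambda m)%:E = \int[mu]_m (prior0 m)%:E.
  rewrite integral_mkcond; apply: eq_integral => m _.
  by rewrite /prior0 !patchE; case: ifP.
move: l1; rewrite /Rintegral E.
have : 0 <= \int[mu]_m (prior0 m)%:E.
  by apply: integral_ge0 => m _; rewrite lee_fin prior0_ge0.
(* An infinite integral would have real value 0 under [fine], contradicting the total mass 1. *)
case: (\int[mu]_m (prior0 m)%:E) => [x|//|//] /= _.
- by move=> ->.
- by move=> /esym/eqP; rewrite oner_eq0.
Qed.

Definition posterior_integral f n X : \bar R :=
  \int[mu]_m (prior0 m * likelihood D n X m * f m)%:E.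

Lemma measurable_posterior_integrand f n : measurable_fun [set: R] f ->
  measurable_fun setT (fun p : R * R =>
    (prior0 p.1 * likelihood D n p.2 p.1 * f p.1)%R).
Proof.
move=> mf; apply: measurable_funM; last exact: measurableT_comp.
apply: measurable_funM; last exact: measurable_likelihood.
by apply: measurableT_comp => //; exact: measurable_prior0.
Qed.

Lemma nneg_family_posterior_integral f :
  measurable_fun [set: R] f -> (forall m, 0 <= f m)%R ->
  nneg_family (posterior_integral f).
Proof.
move=> mf f0 n.
have p0 (p : R * R) : 0 <= (prior0 p.1 * likelihood D n p.2 p.1 * f p.1)%:E.
  by rewrite lee_fin !mulr_ge0// ?prior0_ge0// likelihood_ge0.
split; last by move=> X; apply: integral_ge0 => m _; exact: (p0 (m, X)).
have mp : measurable_fun setT (fun p : measurableTypeR R * measurableTypeR R =>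
    (prior0 p.1 * likelihood D n p.2 p.1 * f p.1)%:E).
  by apply/measurable_EFinP; exact: measurable_posterior_integrand.
exact: (measurable_fun_fubini_tonelli_G (m1 := mu) _ mp p0).
Qed.

Lemma integral_gauss_likelihood m :
  \int[gauss (M%:R * D)]_y (likelihood D M y m)%:E = 1.
Proof.
have ml : measurable_fun setT (fun y : measurableTypeR R => (likelihood D M y m)%:E).
  apply/measurable_EFinP.
  exact: (measurableT_comp (measurable_likelihood D M) (pair1_measurable m)).
have l0 y : 0 <= (likelihood D M y m)%:E by rewrite lee_fin likelihood_ge0.
rewrite (ge0_integral_gauss _ ml l0) -[RHS](integral_gauss_density (M%:R * D) (M%:R * m)).
apply: eq_integral => y _.
by rewrite -(gauss_density_likelihood D0 _ _ M0) [in RHS]EFinM muleC.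
Qed.

(** For each fixed m the likelihood ratio is a martingale under mean 0: by Tonelli and [likelihoodD]
    the batch contributes a factor whose Gaussian integral is 1. *)
Lemma batch_mean_posterior_integral f n X :
  measurable_fun [set: R] f -> (forall m, 0 <= f m)%R ->
  batch_mean M D (posterior_integral f) n X = posterior_integral f n X.
Proof.
move=> mf f0; rewrite /batch_mean /posterior_integral.
have p0 k (p : R * R) : 0 <= (prior0 p.1 * likelihood D k p.2 p.1 * f p.1)%:E.
  by rewrite lee_fin !mulr_ge0// ?prior0_ge0// likelihood_ge0.
have mp : measurable_fun setT (fun p : measurableTypeR R * measurableTypeR R =>
    (prior0 p.2 * likelihood D (n + M) (X + p.1) p.2 * f p.2)%:E).
  have mX : measurable_fun setT (fun p : measurableTypeR R * measurableTypeR R =>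
      (p.2, (X + p.1)%R : measurableTypeR R)).
    by apply: measurable_fun_pair => //; apply: measurable_funD.
  apply/measurable_EFinP.
  exact: (measurableT_comp (measurable_posterior_integrand (n + M) mf) mX).
apply: etrans (fubini_tonelli (m1 := gauss (M%:R * D)) (m2 := mu) _ mp _) _.
  by move=> p; exact: (p0 _ (p.2, (X + p.1)%R)).
apply: eq_integral => m _ /=.
have ml : measurable_fun setT (fun y : measurableTypeR R => (likelihood D M y m)%:E).
  apply/measurable_EFinP.
  exact: (measurableT_comp (measurable_likelihood D M) (pair1_measurable m)).
transitivity (\int[gauss (M%:R * D)]_y
    ((prior0 m * likelihood D n X m * f m)%:E * (likelihood D M y m)%:E)).
  by apply: eq_integral => y _; rewrite likelihoodD -EFinM; congr EFin; ring.
rewrite ge0_integralZl//.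
- by rewrite integral_gauss_likelihood mule1.
- by move=> y _; rewrite lee_fin likelihood_ge0.
- exact: (p0 n (m, X)).
Qed.

Lemma posterior_integral_fin f n X :
  measurable_fun [set: R] f -> (forall m, 0 <= f m)%R ->
  (forall m, f m <= `|m|)%R -> posterior_integral f n X < +oo.
Proof.
move=> mf f0 fle.
(* On [-C, C] the quadratic term only lowers the likelihood, X m is at most |X| C, and [f] is at
   most C. *)
pose K := (expR (D^-1 * (`|X| * C)) * C)%R.
have mp : measurable_fun setT (fun m : R =>
    (prior0 m * likelihood D n X m * f m)%:E).
  apply/measurable_EFinP.
  exact: (measurableT_comp (measurable_posterior_integrand n mf) (pair2_measurable X)).
have ml : measurable_fun setT (fun m : R => (prior0 m)%:E).
  by apply/measurable_EFinP; exact: measurable_prior0.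
have K0 : (0 <= K)%R by rewrite mulr_ge0// ?expR_ge0// ltW.
apply: (@le_lt_trans _ _ (\int[mu]_m (K%:E * (prior0 m)%:E))).
  apply: ge0_le_integral => //.
  - by move=> m _; rewrite lee_fin !mulr_ge0// ?prior0_ge0// likelihood_ge0.
  - exact: measurable_funeM.
  move=> m _; rewrite -EFinM lee_fin.
  have [mC|mC] := boolP (m \in `[- C, C]%R); last first.
    by rewrite prior0_out// !mul0r mulr0.
  have mC' : (`|m| <= C)%R by move: mC; rewrite in_itv/= -ler_norml.
  rewrite -mulrA mulrC; apply: ler_wpM2r; first exact: prior0_ge0.
  apply: ler_pM => //; first exact: likelihood_ge0; last exact: le_trans (fle m) mC'.
  rewrite ler_expR ler_wpM2l ?invr_ge0 ?(ltW D0)//.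
  apply: (@le_trans _ _ (X * m)%R).
    by rewrite gerBl; apply: mulr_ge0 (sqr_ge0 m); rewrite mulr_ge0 ?invr_ge0 ?ler0n.
  apply: (le_trans (ler_norm _)); rewrite normrM.
  by rewrite ler_wpM2l.
rewrite ge0_integralZl//; last by move=> m _; rewrite lee_fin prior0_ge0.
by rewrite integral_prior0 mule1 ltry.
Qed.

End bayes_risk.

(** * The minimum of the mean loss over all strategies *)

Section minimal_mean_loss.
Local Open Scope ereal_scope.
Context (R : realType) (M : nat) (D C : R) (lambda : R -> R)
  (P1 : probability (measurableTypeR R) R).
Hypotheses (D0 : (0 < D)%R) (M0 : (0 < M)%N) (C0 : (0 < C)%R).
Hypothesis priorP : is_prior C lambda.
Hypothesis intP1 : P1.-integrable setT (fun x : measurableTypeR R => (x : R)%:E).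
Hypothesis meanP1 : \int[P1]_x (x : R)%:E = 0.
Notation mu := (@lebesgue_measure R).
Implicit Types (m X : R) (n : nat) (a : seq bool).

(** The expected regret of one step of the known arm; [neg_mean] is that of the unknown arm. *)
Definition pos_mean m : R := Num.max 0%R m.
Definition neg_mean m : R := Num.max 0%R (- m)%R.

Lemma pos_mean_ge0 m : (0 <= pos_mean m)%R.
Proof. by rewrite /pos_mean le_max lexx. Qed.

Lemma neg_mean_ge0 m : (0 <= neg_mean m)%R.
Proof. by rewrite /neg_mean le_max lexx. Qed.

Lemma pos_mean_le m : (pos_mean m <= `|m|)%R.
Proof. by rewrite /pos_mean ge_max normr_ge0 ler_norm. Qed.

Lemma neg_mean_le m : (neg_mean m <= `|m|)%R.
Proof. by rewrite /neg_mean ge_max normr_ge0 -normrN ler_norm. Qed.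

Lemma measurable_pos_mean : measurable_fun [set: R] pos_mean.
Proof. by apply: measurable_maxr. Qed.

Lemma measurable_neg_mean : measurable_fun [set: R] neg_mean.
Proof. by apply: measurable_maxr => //; exact: oppr_measurable. Qed.

Definition G1 := posterior_integral D C lambda pos_mean.
Definition G2 := posterior_integral D C lambda neg_mean.

Lemma nneg_family_G1 : nneg_family G1.
Proof.
exact: (nneg_family_posterior_integral D priorP measurable_pos_mean pos_mean_ge0).
Qed.

Lemma nneg_family_G2 : nneg_family G2.
Proof.
exact: (nneg_family_posterior_integral D priorP measurable_neg_mean neg_mean_ge0).
Qed.

Lemma batch_mean_G1 n X : batch_mean M D G1 n X = G1 n X.
Proof.
exact: (batch_mean_posterior_integral D0 M0 priorP n X
  measurable_pos_mean pos_mean_ge0).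
Qed.

Lemma batch_mean_G2 n X : batch_mean M D G2 n X = G2 n X.
Proof.
exact: (batch_mean_posterior_integral D0 M0 priorP n X
  measurable_neg_mean neg_mean_ge0).
Qed.

Lemma G1_fin n X : G1 n X < +oo.
Proof.
exact: (posterior_integral_fin D0 C0 priorP n X
  measurable_pos_mean pos_mean_ge0 pos_mean_le).
Qed.

Lemma G2_fin n X : G2 n X < +oo.
Proof.
exact: (posterior_integral_fin D0 C0 priorP n X
  measurable_neg_mean neg_mean_ge0 neg_mean_le).
Qed.

Definition action_cost m a (X : R) : \bar R :=
  (pos_mean m * (count negb a)%:R + neg_mean m * (count id a)%:R)%:E.

Definition weighted_cost m a X : \bar R :=
  (prior0 C lambda m * likelihood D (count id a) X m)%:E * action_cost m a X.

Lemma action_cost_ge0 m a X : 0 <= action_cost m a X.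
Proof.
by rewrite lee_fin addr_ge0// mulr_ge0// ?pos_mean_ge0 ?neg_mean_ge0.
Qed.

Lemma nneg_measurable_action_cost m : nneg_measurable (action_cost m).
Proof.
move=> a; split; first exact: measurable_cst.
by move=> X; exact: action_cost_ge0.
Qed.

Lemma jointly_nneg_measurable_weighted_cost :
  jointly_nneg_measurable weighted_cost.
Proof.
move=> a; split; last first.
  move=> m X; apply: mule_ge0; last exact: action_cost_ge0.
  by rewrite lee_fin mulr_ge0// ?likelihood_ge0//; exact: (prior0_ge0 priorP).
have mf : measurable_fun [set: R] (fun m =>
    (pos_mean m * (count negb a)%:R + neg_mean m * (count id a)%:R)%R).
  apply: measurable_funD; apply: measurable_funM => //.
    exact: measurable_pos_mean.
  exact: measurable_neg_mean.
have := measurable_posterior_integrand D priorP (count id a) mf.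
by move=> /measurable_EFinP.
Qed.

Lemma integral_weighted_cost a X :
  \int[mu]_m weighted_cost m a X = final_cost G1 G2 a X.
Proof.
have pl0 m : (0 <= prior0 C lambda m * likelihood D (count id a) X m)%R.
  by rewrite mulr_ge0 ?likelihood_ge0//; exact: (prior0_ge0 priorP).
have mpl f : measurable_fun [set: R] f -> measurable_fun setT (fun m : R =>
    (prior0 C lambda m * likelihood D (count id a) X m * f m)%:E).
  move=> mf; apply/measurable_EFinP.
  exact: (measurableT_comp (measurable_posterior_integrand D priorP (count id a) mf)
    (pair2_measurable X)).
pose h f m := (prior0 C lambda m * likelihood D (count id a) X m * f m)%:E.
transitivity (\int[mu]_m ((count negb a)%:R%:E * h pos_mean m +
    (count id a)%:R%:E * h neg_mean m)).
  apply: eq_integral => m _.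
  by rewrite /h /weighted_cost /action_cost -!EFinM -EFinD; congr EFin; ring.
have h0 f m : (0 <= f m)%R -> 0 <= h f m.
  by move=> f0; rewrite lee_fin mulr_ge0.
have mh1 := mpl _ measurable_pos_mean; have mh2 := mpl _ measurable_neg_mean.
rewrite ge0_integralD//; last 4 first.
- by move=> m _; rewrite mule_ge0 ?lee_fin// mulr_ge0// pos_mean_ge0.
- exact: measurable_funeM.
- by move=> m _; rewrite mule_ge0 ?lee_fin// mulr_ge0// neg_mean_ge0.
- exact: measurable_funeM.
congr (_ + _); rewrite ge0_integralZl ?lee_fin//.
- by move=> m _; rewrite h0// pos_mean_ge0.
- by move=> m _; rewrite h0// neg_mean_ge0.
Qed.

(** At the empty history the likelihood is 1, so the prior density alone is the initial weight of
    the change of measure. *)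
Lemma weighted_lossE sigma N m :
  (loss M D P1 sigma m N * prior0 C lambda m)%:E =
  iter N (backup M D sigma 0) (weighted_cost m) [::] 0%R.
Proof.
have l0 := prior0_ge0 priorP m.
have E := iter_backup_likelihood M sigma D0 m N [::] 0%R l0
  (nneg_measurable_action_cost m).
apply: etrans E.
rewrite likelihood0 mulr1 EFinM muleC; congr (_ * _).
have L := integral_trajectory_law M D sigma P1 m N (nneg_measurable_action_cost m).
apply: etrans L; rewrite (loss_integral M sigma m D0 intP1 meanP1).
by apply: eq_integral => h _; rewrite /action_cost !count_map.
Qed.

Lemma mean_loss_integral N sigma :
  \int[mu]_(m in [set` `[- C, C]%R])
    (loss M D P1 sigma m N * lambda m)%:E =
  iter N (backup M D sigma 0) (final_cost G1 G2) [::] 0%R.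
Proof.
transitivity (\int[mu]_m iter N (backup M D sigma 0) (weighted_cost m) [::] 0%R).
  rewrite integral_mkcond; apply: eq_integral => m _.
  rewrite -weighted_lossE patchE /prior0 patchE.
  by case: ifP => // _; rewrite mulr0.
apply: etrans (integral_iter_backup M D sigma mu 0 N [::] 0%R
  jointly_nneg_measurable_weighted_cost) _.
congr (iter N (backup M D sigma 0) _ [::] 0%R).
by apply/funext => a; apply/funext => X; exact: integral_weighted_cost.
Qed.

(** The loss is at most N |m|, hence at most N C on the support of the prior. This legitimates the
    passage from the real integral in [mean_loss] to the extended one. *)
Lemma mean_loss_fin N sigma :
  iter N (backup M D sigma 0) (final_cost G1 G2) [::] 0%R \is a fin_num.
Proof.
have l0 m := prior0_ge0 priorP m.
have E : iter N (backup M D sigma 0) (final_cost G1 G2) [::] 0%R =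
    \int[mu]_m (loss M D P1 sigma m N * prior0 C lambda m)%:E.
  rewrite -mean_loss_integral integral_mkcond; apply: eq_integral => m _.
  rewrite /prior0 !patchE.
  by case: ifP => // _; rewrite mulr0.
have bnd m := loss_bounds M sigma m D0 intP1 meanP1 N.
rewrite E ge0_fin_numE; last first.
  apply: integral_ge0 => m _; rewrite lee_fin mulr_ge0//.
  by have /andP[] := bnd m.
have ml : measurable_fun setT (fun m : R => (prior0 C lambda m)%:E).
  by apply/measurable_EFinP; exact: measurable_prior0.
have mloss : measurable_fun setT
    (fun m : R => (loss M D P1 sigma m N * prior0 C lambda m)%:E).
  have phiP : jointly_nneg_measurable
      (fun m : measurableTypeR R => iter N (backup M D sigma 0) (weighted_cost m)).
    elim: N {E bnd} => [|N IH]; first exact: jointly_nneg_measurable_weighted_cost.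
    exact: jointly_nneg_measurable_backup.
  have [mphi _] := phiP [::].
  have := measurableT_comp mphi (pair2_measurable (0%R : measurableTypeR R)).
  by apply: eq_measurable_fun => m _; rewrite weighted_lossE.
have NC0 : (0 <= N%:R * C)%R by rewrite mulr_ge0// ltW.
apply: (@le_lt_trans _ _ (\int[mu]_m ((N%:R * C)%:E * (prior0 C lambda m)%:E))).
  apply: ge0_le_integral => //.
  - by move=> m _; rewrite lee_fin mulr_ge0//; have /andP[] := bnd m.
  - exact: measurable_funeM.
  move=> m _; rewrite -EFinM lee_fin.
  have [mC|mC] := boolP (m \in `[- C, C]%R); last first.
    by rewrite prior0_out// !mulr0.
  have mC' : (`|m| <= C)%R by move: mC; rewrite in_itv/= -ler_norml.
  rewrite ler_wpM2r//; have /andP[_ b] := bnd m.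
  by rewrite (le_trans b)// ler_wpM2l.
rewrite ge0_integralZl//; last by move=> m _; rewrite lee_fin.
by rewrite (integral_prior0 priorP) mule1 ltry.
Qed.

Lemma mean_lossE N sigma :
  (mean_loss N M D C P1 lambda sigma)%:E =
  iter N (backup M D sigma 0) (final_cost G1 G2) [::] 0%R.
Proof.
rewrite /mean_loss /Rintegral mean_loss_integral fineK//.
exact: mean_loss_fin.
Qed.

Lemma final_cost0 : final_cost G1 G2 [::] 0 = 0.
Proof. by rewrite /final_cost /= !mul0e adde0. Qed.

Lemma minimum_mean_loss J v :
  v%:E = M%:R%:E * stop_value M D G1 G2 J 0 0%R ->
  bayes_risk_is (J * M) M D C P1 lambda v.
Proof.
move=> vE; split.
  pose sigma := optimal_strategy M D nneg_family_G1 nneg_family_G2 J.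
  exists sigma => //.
  apply: EFin_inj; rewrite mean_lossE vE.
  have := iter_backup_optimal D0 M0 nneg_family_G1 nneg_family_G2
    batch_mean_G1 batch_mean_G2 (j := J) (J := J) (a := [::]) 0%R.
  rewrite final_cost0 add0e subnn mul0n; apply => //; exact: dvdn0.
move=> _ [sigma _ <-].
rewrite -lee_fin mean_lossE vE.
have := stop_value_lower_bound D0 M0 nneg_family_G1 nneg_family_G2
    batch_mean_G1 batch_mean_G2 sigma J (a := [::]) 0%R.
by rewrite final_cost0 add0e; apply; exact: dvdn0.
Qed.

End minimal_mean_loss.

(** * Scaled variables *)

Section rescaling.
Local Open Scope ereal_scope.
Context (R : realType) (N M J : nat) (D C : R) (lambda : R -> R).
Hypotheses (D0 : (0 < D)%R) (M0 : (0 < M)%N) (C0 : (0 < C)%R) (N0 : (0 < N)%N).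
Hypothesis NJM : N = (J * M)%N.
Hypothesis priorP : is_prior C lambda.
Notation mu := (@lebesgue_measure R).
Notation S := (Num.sqrt (N%:R : R)).
Notation eps := (M%:R / N%:R : R)%R.
Notation c := (S * C)%R.
Notation rho := (fun w : R => S^-1 * lambda (S^-1 * w))%R.
Notation G1 := (G1 D C lambda).
Notation G2 := (G2 D C lambda).
Implicit Types (x t w X : R) (n s : nat).

Let S0 : (0 < S)%R.
Proof. by rewrite sqrtr_gt0 ltr0n. Qed.

Let SS : (S ^+ 2 = N%:R)%R.
Proof. by rewrite sqr_sqrtr. Qed.

Let Nneq0 : (N%:R != 0 :> R)%R.
Proof. by rewrite pnatr_eq0 -lt0n. Qed.

(** The substitution m = w / S, whose Jacobian gives the factor [S]. Extending by 0 on both sides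
    lets the range of w be matched pointwise with that of m. *)
Lemma integral_rescale (I : set R) (F f : R -> R) n X :
  measurable_fun [set: R] f -> (forall m, 0 <= f m)%R ->
  (forall w, (F \_ I) w = prior0 C lambda (S^-1 * w) *
    likelihood D n X (S^-1 * w) * f (S^-1 * w))%R ->
  \int[mu]_(w in I) (F w)%:E = S%:E * posterior_integral D C lambda f n X.
Proof.
move=> mf f0 FE.
have mh : measurable_fun setT (fun m : measurableTypeR R =>
    (prior0 C lambda m * likelihood D n X m * f m)%:E).
  apply/measurable_EFinP.
  exact: (measurableT_comp (measurable_posterior_integrand D priorP n mf)
    (pair2_measurable X)).
have h0 m : 0 <= (prior0 C lambda m * likelihood D n X m * f m)%:E.
  by rewrite lee_fin !mulr_ge0// ?likelihood_ge0//; exact: (prior0_ge0 priorP).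
have Si0 : (0 < S^-1)%R by rewrite invr_gt0.
have A := ge0_integral_affine 0%R Si0 mh h0.
rewrite /posterior_integral -A muleA -EFinM divff ?gt_eqF// mul1e.
rewrite integral_mkcond; apply: eq_integral => w _.
by rewrite addr0 -FE !patchE; case: ifP.
Qed.

Lemma likelihood_rescale n t x w : (t * N%:R = n%:R)%R ->
  likelihood D n (S * x) (S^-1 * w) =
  expR (D^-1 * (x * w - 2^-1 * t * w ^+ 2)).
Proof.
move=> tN; have nE : (n%:R = t * S ^+ 2)%R by rewrite SS.
rewrite /likelihood nE; congr expR.
by field; rewrite !gt_eqF.
Qed.

Lemma g1_rescale n t x : (t * N%:R = n%:R)%R ->
  (g1 D c rho x t)%:E = S%:E * G1 n (S * x)%R.
Proof.
move=> tN; rewrite /g1 /Rintegral.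
have E := @integral_rescale [set` `[0, c]%R]
  (fun w => w * expR (D^-1 * (x * w - 2^-1 * t * w ^+ 2)) * rho w)%R
  (@pos_mean R) n (S * x)%R (@measurable_pos_mean R) (@pos_mean_ge0 R).
have Gfin : G1 n (S * x)%R \is a fin_num.
  rewrite ge0_fin_numE; last by have [] := nneg_family_G1 D priorP n.
  exact: G1_fin.
rewrite E ?fineK// ?fin_numM// => w.
rewrite patchE (likelihood_rescale _ _ tN); case: ifPn => [/set_mem|wI].
  rewrite /= in_itv/= => /andP[w0 wc].
  have mC : (S^-1 * w \in `[- C, C])%R.
    rewrite in_itv/= ler_pdivrMl// wc andbT.
    by rewrite (@le_trans _ _ 0%R) ?oppr_le0 ?(ltW C0)// mulr_ge0// ltW.
  have Sw0 : (0 <= S^-1 * w)%R by rewrite mulr_ge0// invr_ge0 ltW.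
  by rewrite (prior0E lambda mC) /pos_mean (max_idPr Sw0) /=; ring.
(* Outside [0, c] the right side vanishes as well: for w < 0 through [pos_mean], for w > c through
   the extended prior. *)
have [w0|w0] := ltP w 0%R.
  rewrite /pos_mean (max_idPl _) ?mulr0//.
  by rewrite pmulr_rle0 ?invr_gt0// ltW.
rewrite prior0_out ?mul0r// in_itv/= ler_pdivrMl//.
move: wI; rewrite notin_setE/= in_itv/= w0/= => /negP wI.
by rewrite (negbTE wI) andbF.
Qed.

Lemma g2_rescale n t x : (t * N%:R = n%:R)%R ->
  (g2 D c rho x t)%:E = S%:E * G2 n (S * x)%R.
Proof.
move=> tN; rewrite /g2 /Rintegral.
have E := @integral_rescale [set` `[(- c)%R, 0%R]%R]
  (fun w => `|w| * expR (D^-1 * (x * w - 2^-1 * t * w ^+ 2)) * rho w)%R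
  (@neg_mean R) n (S * x)%R (@measurable_neg_mean R) (@neg_mean_ge0 R).
have Gfin : G2 n (S * x)%R \is a fin_num.
  rewrite ge0_fin_numE; last by have [] := nneg_family_G2 D priorP n.
  exact: G2_fin.
rewrite E ?fineK// ?fin_numM// => w.
rewrite patchE (likelihood_rescale _ _ tN); case: ifPn => [/set_mem|wI].
  rewrite /= in_itv/= => /andP[cw w0].
  have Sw0 : (S^-1 * w <= 0)%R by rewrite pmulr_rle0 ?invr_gt0.
  have mC : (S^-1 * w \in `[- C, C])%R.
    rewrite in_itv/= ler_pdivlMl// mulrN cw/=.
    exact: le_trans Sw0 (ltW C0).
  have NSw0 : (0 <= - (S^-1 * w))%R by rewrite oppr_ge0.
  by rewrite (prior0E lambda mC) /neg_mean (max_idPr NSw0) ler0_norm//=; ring.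
have [w0|w0] := leP w 0%R; last first.
  rewrite /neg_mean (max_idPl _) ?mulr0//.
  by rewrite oppr_le0 mulr_ge0 ?invr_ge0// ltW.
rewrite prior0_out ?mul0r// in_itv/= ler_pdivlMl// mulrN.
move: wI; rewrite notin_setE/= in_itv/= w0 andbT => /negP wI.
by rewrite (negbTE wI).
Qed.

Context (r r1 r2 : R -> R -> R).
Hypothesis dp : dp_equation eps D c rho r r1 r2.
Notation V := (stop_value M D G1 G2).

(** The hypothesis ties [r] at time [t] to the stopping value and so supplies its measurability and
    sign. The variances agree because S^2 eps = M, and the reflection y -> -y turns the convolution
    into a Gaussian mean. *)
Lemma convolution_rescale t n s x :
  (forall y, M%:R%:E * V s (n + M)%N (S * y)%R = (S * r y t)%:E) ->
  (S * convolution (r ^~ t) (gauss_density (eps * D) 0) x)%:E =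
  M%:R%:E * batch_mean M D (V s) n (S * x)%R.
Proof.
move=> VE.
have VP := nneg_family_stop_value M D (nneg_family_G1 D priorP) (nneg_family_G2 D priorP) s.
have [mV V0] := VP (n + M)%N.
have Mp : (0 < M%:R :> R)%R by rewrite ltr0n.
have epsD0 : (0 < eps * D)%R by rewrite mulr_gt0// divr_gt0// ltr0n.
have rE y : (r y t)%:E = (S^-1 * M%:R)%:E * V s (n + M)%N (S * y)%R.
  by rewrite EFinM -muleA VE -EFinM mulrA mulVf ?gt_eqF// mul1r.
have mr : measurable_fun setT (fun y : measurableTypeR R => (r y t)%:E).
  under eq_fun do rewrite rE.
  apply: measurable_funeM; apply: (measurableT_comp mV).
  exact: measurable_funM.
have r0 y : 0 <= (r y t)%:E.
  by rewrite rE mule_ge0// lee_fin mulr_ge0// ?invr_ge0 ltW.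
have mrD : measurable_fun setT (fun y : measurableTypeR R => (r (x + y) t)%:E).
  by apply: (measurableT_comp mr); exact: measurable_funD.
have mrB : measurable_fun setT (fun y : measurableTypeR R => (r (x - y) t)%:E).
  by apply: (measurableT_comp mr); exact: measurable_funB.
have meanE : M%:R%:E * batch_mean M D (V s) n (S * x)%R =
    S%:E * \int[gauss (eps * D)]_y (r (x + y) t)%:E.
  have mMV : measurable_fun setT (fun y : measurableTypeR R =>
      M%:R%:E * V s (n + M)%N (S * x + y)%R).
    by apply: measurable_funeM; exact: (measurable_shift _ mV).
  have MV0 y : 0 <= M%:R%:E * V s (n + M)%N (S * x + y)%R.
    by rewrite mule_ge0// lee_fin.
  have Z := ge0_integral_gaussZ S0 epsD0 mMV MV0.
  have vE : (S ^+ 2 * (eps * D) = M%:R * D)%R by rewrite SS; field.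
  rewrite vE in Z.
  have BZ := batch_meanZ M D n (S * x)%R (ler0n R M) VP.
  have RZ : \int[gauss (eps * D)]_y (S%:E * (r (x + y) t)%:E) =
      S%:E * \int[gauss (eps * D)]_y (r (x + y) t)%:E.
    by apply: ge0_integralZl => //; rewrite lee_fin ltW.
  apply: etrans (esym BZ) (etrans Z (etrans _ RZ)).
  by apply: eq_integral => y _; rewrite -mulrDr VE EFinM.
have convE : \int[mu]_y (r (x - y) t * gauss_density (eps * D) 0 y)%:E =
    \int[gauss (eps * D)]_y (r (x + y) t)%:E.
  rewrite -(ge0_integral_gauss_opp epsD0 mrD (fun=> r0 _)).
  rewrite (ge0_integral_gauss _ mrB (fun=> r0 _)).
  by apply: eq_integral => y _; rewrite EFinM.
(* [convolution] is a real integral, so finiteness must be known. The value is at most the cost of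
   stopping, whose mean is again a multiple of the finite [G1]. *)
have fin : \int[gauss (eps * D)]_y (r (x + y) t)%:E < +oo.
  have G1fam := nneg_family_G1 D priorP.
  have le : batch_mean M D (V s) n (S * x)%R <= s%:R%:E * G1 n (S * x)%R.
    rewrite -(batch_mean_G1 D0 M0 priorP) -batch_meanZ//.
    apply: le_batch_mean => //; first exact: nneg_familyZ.
    by move=> k Y; exact: stop_value_le.
  have lt : M%:R%:E * batch_mean M D (V s) n (S * x)%R < +oo.
    apply: (@le_lt_trans _ _ (M%:R%:E * (s%:R%:E * G1 n (S * x)%R))).
      by rewrite lee_wpmul2l// lee_fin.
    by rewrite muleA lte_mul_pinfty ?mule_ge0 ?lee_fin ?ler0n//; exact: G1_fin.
  move: lt; rewrite meanE; case: (\int[_]_y _) => [z _||_].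
  - exact: ltry.
  - by rewrite gt0_muley ?lte_fin.
  - by [].
rewrite meanE -convE EFinM; congr (_ * _).
rewrite /convolution /Rintegral fineK// convE ge0_fin_numE//.
by apply: integral_ge0 => y _; exact: r0.
Qed.

(** Backward induction in the number [s] of batches left, at time t = (J - s) eps. The constants fit
    because g_i = S G_i, S^2 = N = J M and 1 - t = s / J: S (1 - t) g_1 = M s G_1 and S eps g_2 = M
    G_2. *)
Lemma stop_value_dp s x : (s <= J)%N ->
  M%:R%:E * V s ((J - s) * M)%N (S * x)%R = (S * r x ((J - s)%:R * eps))%:E.
Proof.
have J0 : (0 < J)%N by move: N0; rewrite NJM muln_gt0 => /andP[].
have Mneq0 : (M%:R != 0 :> R)%R by rewrite pnatr_eq0 -lt0n.
have Jneq0 : (J%:R != 0 :> R)%R by rewrite pnatr_eq0 -lt0n.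
have NE : (N%:R = J%:R * M%:R :> R)%R by rewrite NJM natrM.
have Jeps : (J%:R * eps = 1)%R by rewrite NE; field; rewrite Mneq0.
have eps0 : (0 < eps)%R by rewrite divr_gt0// ltr0n.
have grid j : (j <= J)%N -> grid_time eps (j%:R * eps)%R.
  move=> jJ; split; last by exists j.
  by rewrite -[leRHS]Jeps ler_wpM2r ?(ltW eps0)// ler_nat.
elim: s x => [|s IH] x sJ.
  have [rE /(_ _)[]] := dp x (grid J (leqnn J)); first by rewrite Jeps.
  by move=> r1E r2E _; rewrite subn0 rE r1E r2E minxx mulr0 mule0.
set j := (J - s.+1)%N.
have jJ : (j < J)%N by rewrite ltn_subrL.
have jS : j.+1 = (J - s)%N by rewrite subnSK.
have tn : (j%:R * eps * N%:R = (j * M)%:R)%R by rewrite natrM; field.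
have [rE _ /(_ _)[|r1E r2E]] := dp x (grid j (ltnW jJ)).
  by rewrite -[ltRHS]Jeps ltr_pM2r// ltr_nat.
have Mp : (0 <= M%:R :> R)%R by [].
have nextE y : M%:R%:E * V s (j * M + M)%N (S * y)%R =
    (S * r y (j%:R * eps + eps))%:E.
  rewrite -mulSnr jS IH ?(ltnW sJ)//.
  by congr (_ * r _ _)%:E; rewrite -jS -natr1 mulrDl mul1r.
have convE := convolution_rescale x nextE.
have G1E := g1_rescale x tn; have G2E := g2_rescale x tn.
have S1 : (S^-1 * S = 1)%R by rewrite mulVf// gt_eqF.
have invS (y : R) (z : \bar R) : y%:E = S%:E * z -> z = (S^-1 * y)%:E.
  by move=> E; rewrite EFinM E muleA -EFinM S1 mul1e.
have := invS _ _ G1E; have := invS _ _ G2E => {}G2E {}G1E.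
have bE : batch_mean M D (V s) (j * M)%N (S * x)%R =
    (M%:R^-1 * (S * convolution (r ^~ (j%:R * eps + eps))
      (gauss_density (eps * D) 0) x))%:E.
  by rewrite EFinM convE muleA -EFinM mulVf// mul1e.
rewrite /= G1E G2E bE -!EFinM -EFinD -EFin_min -EFinM; congr EFin.
rewrite rE r1E r2E !minr_pMr// ?(ltW S0)//.
have sE : (s.+1%:R = J%:R - j%:R :> R)%R.
  by rewrite -natrB ?(ltnW jJ)// subKn.
have Sneq0 : (S != 0)%R by rewrite gt_eqF.
(* Removing the inverse square root makes both sides linear in [S], so that [field] need not know
   that S^2 = N. *)
have SiE : (S^-1 = S / (J%:R * M%:R))%R.
  by apply: (mulfI Sneq0); rewrite divff// mulrA -expr2 SS NE divff// mulf_neq0.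
have epsE : (eps = J%:R^-1)%R by rewrite NE; field; rewrite Mneq0 Jneq0.
rewrite SiE epsE sE.
by congr (Num.min _ _); field; rewrite ?Mneq0 ?Jneq0.
Qed.

End rescaling.

Theorem theorem3p3 (R : realType) (N M : nat) (D C : R)
    (P1 : probability (measurableTypeR R) R) (lambda : R -> R)
    (r r1 r2 : R -> R -> R) :
  let eps : R := M%:R / N%:R in
  let c : R := Num.sqrt N%:R * C in
  let rho : R -> R := fun w =>
    (Num.sqrt N%:R)^-1 * lambda ((Num.sqrt N%:R)^-1 * w) in
  (0 < N)%N -> (0 < M)%N -> (M %| N)%N ->
  0 < D -> 0 < C ->
  P1.-integrable setT (fun x : measurableTypeR R => (x : R)%:E) ->
  ('E_P1[fun x : measurableTypeR R => (x : R)] = 0)%E ->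
  is_prior C lambda ->
  dp_equation eps D c rho r r1 r2 ->
  bayes_risk_is N M D C P1 lambda (Num.sqrt N%:R * r 0 0).
Proof.
move=> eps c rho N0 M0 MN D0 C0 intP1 meanP1 priorP dp.
rewrite unlock in meanP1.
have NJM : N = (N %/ M * M)%N by rewrite divnK.
have := @stop_value_dp R N M (N %/ M)%N D C lambda D0 M0 C0 N0 NJM priorP
  r r1 r2 dp _ 0 (leqnn _).
rewrite subnn mul0n mul0r mulr0 => vE.
rewrite [X in bayes_risk_is X]NJM.
exact: (minimum_mean_loss D0 M0 C0 priorP intP1 meanP1 (esym vE)).
Qed.
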